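(* Let $\psi_1,\dots,\psi_N\in D(\mathcal L)$ be linearly independent observables and let $\mathcal L_{\mathbb V}$, $\tilde{\mathcal L}_m\in\mathbb R^{N\times N}$ be as in the context, where the data satisfy (iid) or (erg). Let $z_0\in\mathbb R^N$ and let $z,\tilde z$ be the solutions of $$\dot z=\mathcal L_{\mathbb V}z,\quad z(0)=z_0,\qquad\qquad \dot{\tilde z}=\tilde{\mathcal L}_m\tilde z,\quad\tilde z(0)=z_0.$$ Then for any $T>0$ and $\delta,\varepsilon>0$ there is $m_0\in\mathbb N$ such that for all $m\ge m_0$ data points $$\min_{t\in[0,T]}\mathbb P\big(\|z(t)-\tilde z(t)\|_2\le\varepsilon\big)\ge1-\delta,$$ i.e. $\mathbb P(\|z(t)-\tilde z(t)\|_2\le\varepsilon)\ge1-\delta$ for every $t\in[0,T]$.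
   Context: Dynamics. $\mathbb X\subset\mathbb R^d$ carries its Borel $\sigma$-algebra and a probability measure $\mu$. Consider $\mathrm dX_t=F(X_t)\,\mathrm dt+\sigma(X_t)\,\mathrm dW_t$ with $F:\mathbb X\to\mathbb R^d$, $\sigma:\mathbb X\to\mathbb R^{d\times d}$ satisfying standard Lipschitz conditions ensuring global existence of solutions in $\mathbb X$, $W_t$ a $d$-dimensional Brownian motion ($\sigma\equiv0$ is allowed). The Koopman semigroup is $\mathcal K^tf(x)=\mathbb E[f(X_t)\mid X_0=x]$. The measure $\mu$ is called invariant if $\int\mathcal K^tf\,\mathrm d\mu=\int f\,\mathrm d\mu$ for all bounded measurable $f$ and $t\ge0$. Assume one of: (a) $\mathbb X$ is compact and forward invariant ($\mathbb P^{x}(X_t\in\mathbb X)=1$ for all $x\in\mathbb X$, $t\ge0$), $\mu$ is normalized Lebesgue measure, and $\mathcal K^t$ extends to a strongly continuous semigroup on $L^2_\mu(\mathbb X)$; (b) $\mu$ is invariant (then $\mathcal K^t$ extends to a strongly continuous contraction semigroup on $L^2_\mu(\mathbb X)$). $\mathcal L$ with domain $D(\mathcal L)$ is the generator of $\mathcal K^t$ on $L^2_\mu(\mathbb X)$; $\langle f,g\rangle_\mu=\int fg\,\mathrm d\mu$; $L^2_{\mu,0}(\mathbb X)=\{f\in L^2_\mu(\mathbb X):\langle f,1\rangle_\mu=0\}$. Data $x_0,\dots,x_{m-1}$: (iid) drawn i.i.d. from the measure $\mu$ of (a) or (b); or (erg) (b) holds with $\mu$ the unique invariant measure, $x_k=X_{k\Delta_t}$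 for a single trajectory with $X_0\sim\mu$ and step $\Delta_t>0$, and $\|\mathcal K^t\|_{L^2_{\mu,0}(\mathbb X)\to L^2_{\mu,0}(\mathbb X)}\le Me^{-\omega t}$ for all $t\ge0$, with some $M\ge1$, $\omega>0$. Matrices. $C_{ij}=\langle\psi_i,\psi_j\rangle_\mu$, $A_{ij}=\langle\psi_i,\mathcal L\psi_j\rangle_\mu$, $\mathcal L_{\mathbb V}=C^{-1}A$. With $\Psi=(\psi_1,\dots,\psi_N)^\top$ and $\mathcal L\Psi=(\mathcal L\psi_1,\dots,\mathcal L\psi_N)^\top$, $\tilde C_m=\frac1m\sum_{k=0}^{m-1}\Psi(x_k)\Psi(x_k)^\top$, $\tilde A_m=\frac1m\sum_{k=0}^{m-1}\Psi(x_k)(\mathcal L\Psi)(x_k)^\top$, $\tilde{\mathcal L}_m=\tilde C_m^{-1}\tilde A_m$ (defined when $\tilde C_m$ is invertible; the event in the claim includes invertibility of $\tilde C_m$). *)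

(* Defs.v *)
From HB Require Import structures.
From mathcomp Require Import all_boot all_order all_algebra.
From mathcomp Require Import all_classical all_reals all_analysis.

Set Implicit Arguments.
Unset Strict Implicit.
Unset Printing Implicit Defensive.

Import Order.TTheory GRing.Theory Num.Theory.
Import numFieldNormedType.Exports.

Local Open Scope classical_set_scope.
Local Open Scope ring_scope.

(* A nonempty subset [X] of R^d seen as a topological space of its own, with
   the topology induced by R^d.  Measurable types are pointed, hence the
   nonemptiness witness (it carries no information: a probability measure on
   [X] exists only if [X] is nonempty). *)
Definition subspace_of (R : realType) (d : nat) (X : set 'cV[R]_d)
  (X0 : X !=set0) : Type := X.

Section subspace_of.
Context (R : realType) (d : nat) (X : set 'cV[R]_d) (X0 : X !=set0).

HB.instance Definition _ := Topological.copy (subspace_of X0) (set_type X).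
HB.instance Definition _ :=
  isPointed.Build (subspace_of X0) (SigSub (mem_set (projT2 (cid X0)))).

End subspace_of.

Definition state_space (R : realType) (d : nat) (X : set 'cV[R]_d)
  (X0 : X !=set0) : Type := g_sigma_algebraType (@open (subspace_of X0)).

HB.instance Definition _ (R : realType) (d : nat) (X : set 'cV[R]_d)
    (X0 : X !=set0) :=
  Measurable.copy (state_space X0)
    (g_sigma_algebraType (@open (subspace_of X0))).

Definition borel_space (R : realType) (d : nat) : Type :=
  g_sigma_algebraType (@open 'cV[R]_d).

HB.instance Definition _ (R : realType) (d : nat) :=
  Measurable.copy (borel_space R d) (g_sigma_algebraType (@open 'cV[R]_d)).

Definition ambient (R : realType) (d : nat) (X : set 'cV[R]_d) (X0 : X !=set0)
  (x : state_space X0) : 'cV[R]_d := set_val (x : X).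

(* The values on boxes determine the measure. *)
Definition is_lebesgue (R : realType) (d : nat)
    (lambda : {measure set (borel_space R d) -> \bar R}) : Prop :=
  forall a b : 'cV[R]_d, (forall i, a i 0 <= b i 0) ->
    lambda [set x : 'cV[R]_d | forall i, a i 0 <= x i 0 <= b i 0]
    = (\prod_i (b i 0 - a i 0))%:E.

Definition normalized_lebesgue (R : realType) (d : nat) (X : set 'cV[R]_d)
    (X0 : X !=set0) (mu : probability (state_space X0) R) : Prop :=
  exists lambda : {measure set (borel_space R d) -> \bar R},
    is_lebesgue lambda /\
    forall B : set (borel_space R d), measurable B ->
      mu (@ambient R d X X0 @^-1` B)
      = ((fine (lambda X))^-1%:E * lambda (X `&` B))%E.

Section sde.
Context (R : realType) (d : nat).
Context (dO : measure_display) (Omega : measurableType dO)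
  (P : probability Omega R).

Definition filtration (G : R -> set_system Omega) : Prop :=
  [/\ forall t, 0 <= t -> sigma_algebra [set: Omega] (G t),
      forall t, 0 <= t -> G t `<=` measurable
    & forall s t, 0 <= s -> s <= t -> G s `<=` G t].

Definition brownian_motion (G : R -> set_system Omega)
    (W : R -> Omega -> 'cV[R]_d) : Prop :=
  [/\ {ae P, forall w, W 0 w = 0},
      {ae P, forall w, {within `[0, +oo[, continuous (W ^~ w)}},
      forall t, 0 <= t -> forall (i : 'I_d) (B : set R), measurable B ->
        G t [set w | B (W t w i 0)]
    & forall s t, 0 <= s -> s < t ->
        forall A : set Omega, G s A ->
        forall B : 'I_d -> set R, (forall i, measurable (B i)) ->
          P (A `&` [set w | forall i, B i (W t w i 0 - W s w i 0)])
          = (P A * \prod_i normal_prob 0 (Num.sqrt (t - s)) (B i))%E].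

Definition cvg_in_probability (Y : nat -> Omega -> 'cV[R]_d)
    (Z : Omega -> 'cV[R]_d) : Prop :=
  forall (i : 'I_d) (e : R), 0 < e ->
    (fun n => P [set w | e <= `|Y n w i 0 - Z w i 0|]) @ \oo --> 0%:E.

(* The Ito integral of [H] against [W] over [s, t], for [H] adapted with
   continuous paths: for such integrands it is the limit in probability of the
   left-endpoint Riemann sums along partitions whose mesh tends to 0. *)
Definition ito_sum (W : R -> Omega -> 'cV[R]_d) (H : R -> Omega -> 'M[R]_d)
    (s t : R) (n : nat) (w : Omega) : 'cV[R]_d :=
  let u (k : nat) := s + (t - s) * k%:R / n.+1%:R in
  \sum_(k < n.+1) H (u k) w *m (W (u k.+1) w - W (u k) w).

Definition is_ito_integral (W : R -> Omega -> 'cV[R]_d)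
    (H : R -> Omega -> 'M[R]_d) (s t : R) (I : Omega -> 'cV[R]_d) : Prop :=
  (forall i, measurable_fun [set: Omega] (fun w => I w i 0)) /\
  cvg_in_probability (ito_sum W H s t) I.

Context (X : set 'cV[R]_d) (X0 : X !=set0).

(* dY = F(Y) dt + sigma(Y) dW on [0, +oo[, in integral form on every [s, t];
   [Y] takes its values in [X], which is how forward invariance enters. *)
Definition sde_solution (F : state_space X0 -> 'cV[R]_d)
    (sigma : state_space X0 -> 'M[R]_d) (G : R -> set_system Omega)
    (W : R -> Omega -> 'cV[R]_d) (Y : R -> Omega -> state_space X0) : Prop :=
  [/\ filtration G,
      brownian_motion G W,
      {ae P, forall w, {within `[0, +oo[, continuous (fun t => ambient (Y t w))}},
      forall t, 0 <= t -> forall B : set (state_space X0), measurable B ->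
        G t (Y t @^-1` B)
    & forall s t, 0 <= s -> s <= t ->
        exists I, is_ito_integral W (fun u w => sigma (Y u w)) s t I /\
          {ae P, forall w, forall i,
            ambient (Y t w) i 0 = ambient (Y s w) i 0
              + (\int[lebesgue_measure]_(u in `[s, t]) F (Y u w) i 0)%R
              + I w i 0}].

End sde.

Section koopman.
Context (R : realType) (d : nat) (X : set 'cV[R]_d) (X0 : X !=set0).
Local Notation S := (state_space X0).

Definition lipschitz_coefficients (F : S -> 'cV[R]_d) (sigma : S -> 'M[R]_d)
    : Prop :=
  exists K : R, forall x y : S,
    `|F x - F y| <= K * `|ambient x - ambient y| /\
    `|sigma x - sigma y| <= K * `|ambient x - ambient y|.

(* Solutions staying in [X] for all times exist from every point, and [p t]
   is the conditional distribution of Y_t given Y_0, for every solution Y: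
   p t x B = P (Y_t \in B | Y_0 = x). *)
Definition transition_kernel (F : S -> 'cV[R]_d) (sigma : S -> 'M[R]_d)
    (p : R -> R.-pker S ~> S) : Prop :=
  (forall x : S,
    exists (dO : measure_display) (Omega : measurableType dO)
      (P : probability Omega R) (G : R -> set_system Omega)
      (W : R -> Omega -> 'cV[R]_d) (Y : R -> Omega -> S),
      sde_solution P F sigma G W Y /\ {ae P, forall w, Y 0 w = x}) /\
  (forall (dO : measure_display) (Omega : measurableType dO)
      (P : probability Omega R) (G : R -> set_system Omega)
      (W : R -> Omega -> 'cV[R]_d) (Y : R -> Omega -> S),
    sde_solution P F sigma G W Y ->
    forall t, 0 <= t -> forall A B : set S, measurable A -> measurable B ->
      P (Y 0 @^-1` A `&` Y t @^-1` B)
      = (\int[P]_(w in Y 0%R @^-1` A) p t (Y 0%R w) B)%E).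

Definition bounded_measurable (f : S -> R) : Prop :=
  measurable_fun [set: S] f /\ exists M : R, forall x, `|f x| <= M.

(* E [f(Y_t) | Y_0 = x] *)
Definition koopman (p : R -> R.-pker S ~> S) (t : R) (f : S -> R) (x : S) : R :=
  (\int[p t x]_y f y)%R.

Definition invariant_measure (p : R -> R.-pker S ~> S) (mu : probability S R)
    : Prop :=
  forall f, bounded_measurable f -> forall t, 0 <= t ->
    (\int[mu]_x koopman p t f x)%R = (\int[mu]_x f x)%R.

End koopman.

(* Square-integrable functions.  Elements of the Hilbert space L^2 are their
   classes modulo equality a.e., so the axioms below are stated modulo
   equality a.e. and with the seminorm. *)
Notation L2 mu := (LfunType mu (lee1n 2)).

Section L2.
Context (R : realType) (dS : measure_display) (S : measurableType dS)
  (mu : probability S R).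

Definition inner (f g : S -> R) : R := (\int[mu]_x (f x * g x))%R.

Definition L2norm (f : L2 mu) : R := fine ('N[mu]_2%:E[EFin \o f])%E.

Definition c0_semigroup (U : R -> L2 mu -> L2 mu) : Prop :=
  [/\ forall t, 0 <= t -> forall (a : R) (f g : L2 mu),
        {ae mu, forall x, U t (a *: f + g) x = a * U t f x + U t g x},
      forall t, 0 <= t ->
        exists C : R, forall f, L2norm (U t f) <= C * L2norm f,
      forall f, {ae mu, forall x, U 0 f x = f x},
      forall s t, 0 <= s -> 0 <= t -> forall f,
        {ae mu, forall x, U (s + t) f x = U s (U t f) x}
    & forall f, L2norm (U t f - f) @[t --> 0^'+] --> 0].

(* [f] lies in the domain of the generator of [U], and [g] is (a representative
   of) its image. *)
Definition generates (U : R -> L2 mu -> L2 mu) (f g : L2 mu) : Prop :=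
  L2norm (h^-1 *: (U h f - f) - g) @[h --> 0^'+] --> 0.

(* |U_t| <= M e^(- omega t) on the orthogonal complement of the constants. *)
Definition exponentially_stable (U : R -> L2 mu -> L2 mu) : Prop :=
  exists M omega : R, [/\ 1 <= M, 0 < omega &
    forall t, 0 <= t -> forall f : L2 mu, inner f (cst 1) = 0 ->
      L2norm (U t f) <= M * expR (- omega * t) * L2norm f].

Definition lin_indep (N : nat) (psi : 'I_N -> L2 mu) : Prop :=
  forall c : 'I_N -> R,
    {ae mu, forall x, \sum_i c i * psi i x = 0} -> forall i, c i = 0.

End L2.

(* Bounded functions are dense in L^2, so that [U] is determined, modulo equality
   a.e., as the continuous extension of the Koopman operators. *)
Definition koopman_semigroup (R : realType) (d : nat) (X : set 'cV[R]_d)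
    (X0 : X !=set0) (p : R -> R.-pker (state_space X0) ~> (state_space X0))
    (mu : probability (state_space X0) R) (U : R -> L2 mu -> L2 mu) : Prop :=
  c0_semigroup U /\
  forall t, 0 <= t -> forall f : L2 mu, bounded_measurable f ->
    {ae mu, forall x, U t f x = koopman p t f x}.

Section data.
Context (R : realType) (dO : measure_display) (Omega : measurableType dO)
  (P : probability Omega R).

Definition iid_sample (dS : measure_display) (S : measurableType dS)
    (mu : probability S R) (x : nat -> Omega -> S) : Prop :=
  [/\ forall k, measurable_fun [set: Omega] (x k),
      forall k (B : set S), measurable B -> P (x k @^-1` B) = mu B
    & forall (n : nat) (B : nat -> set S), (forall k, measurable (B k)) ->
        P [set w | forall k, (k < n)%N -> B k (x k w)]
        = (\prod_(k < n) P (x k @^-1` B k))%E].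

Definition ergodic_sample (d : nat) (X : set 'cV[R]_d) (X0 : X !=set0)
    (F : state_space X0 -> 'cV[R]_d) (sigma : state_space X0 -> 'M[R]_d)
    (p : R -> R.-pker (state_space X0) ~> (state_space X0))
    (mu : probability (state_space X0) R) (U : R -> L2 mu -> L2 mu)
    (x : nat -> Omega -> state_space X0) : Prop :=
  [/\ invariant_measure p mu,
      forall nu : probability (state_space X0) R, invariant_measure p nu ->
        forall A : set (state_space X0), measurable A -> nu A = mu A,
      exponentially_stable U
    & exists (Dt : R) (G : R -> set_system Omega) (W : R -> Omega -> 'cV[R]_d)
        (Y : R -> Omega -> state_space X0),
        [/\ 0 < Dt,
            sde_solution P F sigma G W Y,
            forall A : set (state_space X0), measurable A ->
              P (Y 0 @^-1` A) = mu A
          & forall k w, x k w = Y (k%:R * Dt) w]].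

End data.

Section matrices.
Context (R : realType) (dS : measure_display) (S : measurableType dS) (N : nat).

Definition gram_mx (mu : probability S R) (psi phi : 'I_N -> S -> R)
    : 'M[R]_N := \matrix_(i, j) inner mu (psi i) (phi j).

Definition stack (psi : 'I_N -> S -> R) (x : S) : 'cV[R]_N := \col_i psi i x.

Definition empirical_mx (psi phi : 'I_N -> S -> R) (m : nat) (x : nat -> S)
    : 'M[R]_N :=
  m%:R^-1 *: \sum_(k < m) stack psi (x k) *m (stack phi (x k))^T.

End matrices.

Definition solves_linear_ode (R : realType) (N : nat) (M : 'M[R]_N)
    (z0 : 'cV[R]_N) (z : R -> 'cV[R]_N) : Prop :=
  [/\ z 0 = z0, {within `[0, +oo[, continuous z}
    & forall t : R, 0 < t -> is_derive t 1 z (M *m z t)].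

Definition norm2 (R : realType) (N : nat) (v : 'cV[R]_N) : R :=
  Num.sqrt (\sum_i v i 0 ^+ 2).

(* Main.v *)
(* Let C, A be the Gram matrices and C_m, A_m their empirical counterparts.
   Every integrable f satisfies the weak law E|1/m sum_k f(x_k) - int f dmu| -> 0:
   this property is closed under linear combinations and, since x_k has law mu,
   under L^1(mu) limits, so it suffices to prove it for indicators, where
   Chebyshev's argument only needs cov(1_A(x_k), 1_A(x_l)) <= K r^(l-k) with r < 1.
   For i.i.d. data r = 0 works.  For ergodic data, the solution restarted at time
   k Dt is again a solution with initial law mu, so the covariance equals
   <1_A, U_t (1_A - mu A)> with t = (l - k) Dt, and decays by exponential stability.
   The weak law needs only that psi_i psi_j and psi_i L psi_j be integrable.
   Finally C_m^-1 A_m is close to C^-1 A as soon as (C_m, A_m) is close to (C, A),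
   and Gronwall's inequality transfers this to the solutions on [0, T].
   Solutions are limits of the Taylor polynomials of the exponential, which makes
   the event of the statement measurable. *)
Require Import Defs.
From HB Require Import structures.
From mathcomp Require Import all_boot all_order all_algebra finmap.
From mathcomp Require Import all_classical all_reals all_analysis.
From mathcomp Require Import measurable_realfun ring lra.

Set Implicit Arguments.
Unset Strict Implicit.
Unset Printing Implicit Defensive.

Import Order.TTheory GRing.Theory Num.Theory.
Import numFieldNormedType.Exports.

Local Open Scope classical_set_scope.
Local Open Scope ring_scope.

(** * Linear ODEs *)

Section ode.
Context {R : realType}.
Implicit Types (f g : R -> R) (t T c b : R).

Lemma le_init_derive_le0 f (df : R -> R) T : 0 <= T ->
  {within `[0, +oo[, continuous f} ->
  (forall t, 0 < t -> is_derive t 1 f (df t)) ->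
  (forall t, 0 < t -> t <= T -> df t <= 0) ->
  forall t, 0 <= t -> t <= T -> f t <= f 0.
Proof.
move=> T0 cf f' df0 t t0 tT.
have dT s : s \in `]0, T[%R -> 0 < s /\ s <= T.
  by rewrite in_itv/= => /andP[s0 /ltW].
apply: (@ler0_derive1_le_cc _ f 0 T) => //.
- by move=> s /dT[s0 _]; have [] := f' s s0.
- move=> s /dT[s0 sT]; rewrite derive1E.
  by have [_ ->] := f' s s0; apply: df0.
- apply: continuous_subspaceW cf => s /=; rewrite !in_itv/= andbT.
  by case/andP.
- by rewrite in_itv/= t0.
- by rewrite in_itv/= lexx.
Qed.

Lemma within_continuousM (A : set R) f g :
  {within A, continuous f} -> {within A, continuous g} ->
  {within A, continuous (fun t => f t * g t)}.
Proof. by move=> cf cg t; apply: cvgM; [exact: cf|exact: cg]. Qed.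

(** The function v(s) = f(s) e^(-cs) - b s has derivative (f' - c f) e^(-cs) - b <= b (e^(-cs) - 1)
    <= 0, so v(t) <= v(0) = 0. *)
Lemma gronwall f (df : R -> R) T c b : 0 <= T -> 0 <= c -> 0 <= b ->
  {within `[0, +oo[, continuous f} ->
  (forall t, 0 < t -> is_derive t 1 f (df t)) ->
  f 0 = 0 ->
  (forall t, 0 < t -> t <= T -> df t <= c * f t + b) ->
  forall t, 0 <= t -> t <= T -> f t <= b * t * expR (c * t).
Proof.
move=> T0 c0 b0 cf f' f0 dfle t t0 tT.
pose v s := f s * expR (- c * s) - b * s.
pose dv s := (df s - c * f s) * expR (- c * s) - b.
have cv : {within `[0, +oo[, continuous v}.
  apply: within_continuousB.
    apply: within_continuousM => //; apply: continuous_subspaceT => s.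
    by apply: continuous_comp; [apply: continuousM; [exact: cvg_cst|exact: cvg_id]
      |exact: continuous_expR].
  apply: continuous_subspaceT => s; apply: continuousM; [exact: cvg_cst|exact: cvg_id].
have v' (s : R) : 0 < s -> is_derive s 1 v (dv s).
  move=> s0; have := f' s s0 => fs.
  apply: is_derive_eq.
  rewrite /dv /GRing.scale/=.
  by ring.
have : v t <= v 0.
  apply: (le_init_derive_le0 T0 cv v') => // s s0 sT.
  have := dfle s s0 sT; rewrite -lerBlDl => h.
  rewrite /dv subr_le0; apply: le_trans (_ : b * expR (- c * s) <= b).
    by rewrite ler_wpM2r ?expR_ge0.
  by rewrite ler_piMr// expR_le1 mulNr oppr_le0 mulr_ge0// ltW.
rewrite /v f0 mul0r mulr0 subr0 subr_le0 => h.
by rewrite -ler_pdivrMr ?expR_gt0// -expRN -mulNr.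
Qed.

Lemma is_derive_monomial (k : nat) (a t : R) :
  is_derive t 1 (fun t => a * t ^+ k) (a * k%:R * t ^+ k.-1).
Proof.
have -> : (fun t => a * t ^+ k) = a *: (id ^+ k).
  by apply/funext => r; rewrite !fctE.
apply: is_derive_eq; rewrite /GRing.scale/= mulr1 -mulr_natr; ring.
Qed.

(** The difference of the two sides is half of (K - a)(x + y)^2 + (K + a)(x - y)^2. *)
Lemma ler_bilin (K a x y : R) : `|a| <= K -> 2 * x * (a * y) <= K * (x ^+ 2 + y ^+ 2).
Proof.
move=> /ler_normlP[a1 a2].
have h1 : 0 <= (K - a) * (x + y) ^+ 2 by rewrite mulr_ge0 ?sqr_ge0// subr_ge0.
have h2 : 0 <= (K + a) * (x - y) ^+ 2 by rewrite mulr_ge0 ?sqr_ge0//; lra.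
lra.
Qed.

Lemma ler_bilin_sqr (a x y E : R) : `|a * y| <= E -> 2 * x * (a * y) <= x ^+ 2 + E ^+ 2.
Proof.
move=> aE; have := sqr_ge0 (x - a * y).
suff : (a * y) ^+ 2 <= E ^+ 2 by lra.
by rewrite -[leLHS]real_normK ?num_real// lerXn2r ?nnegrE// (le_trans _ aE).
Qed.

Variable N : nat.
Implicit Types (M : 'M[R]_N) (z : R -> 'cV[R]_N).

Lemma solves_linear_ode_coord M (z0 : 'cV[R]_N) z : solves_linear_ode M z0 z ->
  forall i, [/\ z 0 i 0 = z0 i 0, {within `[0, +oo[, continuous (fun t => z t i 0)} &
   forall t, 0 < t -> is_derive t 1 (fun t => z t i 0) (\sum_j M i j * z t j 0)].
Proof.
move=> [z00 cz dz] i; split; first by rewrite z00.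
- move=> t.
  exact: (cvg_comp _ _ (cz t) (@coord_continuous _ _ _ i 0 (z t))).
- move=> t /dz [d e].
  have di := (derivable_mxP _ _ _).1 d i 0.
  apply: DeriveDef => //.
  by move/(congr1 (fun A : 'cV[R]_N => A i 0)) : e; rewrite derive_mx// !mxE.
Qed.

Lemma bounded_coord z T : 0 <= T ->
  (forall i, {within `[0, +oo[, continuous (fun t => z t i 0)}) ->
  exists2 B : R, 0 <= B & forall t i, 0 <= t -> t <= T -> `|z t i 0| <= B.
Proof.
move=> T0 cz.
have h i : exists B, forall t, 0 <= t -> t <= T -> `|z t i 0| <= B.
  have ci : {within `[0, T], continuous (fun t => `|z t i 0|)}.
    move=> t; apply: cvg_norm; apply: continuous_subspaceW (cz i) t => s /=.
    by rewrite !in_itv/= andbT => /andP[].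
  have [c _ hc] := EVT_max T0 ci.
  by exists `|z c i 0| => t t0 tT; apply: hc; rewrite in_itv/= t0.
pose b i := sval (cid (h i)).
have bP i := svalP (cid (h i)).
exists (\sum_i `|b i|); first by apply: sumr_ge0.
move=> t i t0 tT; apply: le_trans (bP i t t0 tT) _.
rewrite (bigD1 i)//=; apply: le_trans (ler_norm _) _.
by rewrite lerDl sumr_ge0.
Qed.

(** Gronwall is applied to the squared Euclidean distance u, which is differentiable everywhere. The
    splitting M z - M' z' = M' (z - z') + (M - M') z requires an a priori bound only for the
    unperturbed solution [z]. *)
Lemma linear_ode_perturbation M M' (z0 : 'cV[R]_N) z z' T (B K eta : R) :
  solves_linear_ode M z0 z -> solves_linear_ode M' z0 z' ->
  0 <= T -> 0 <= K -> 0 <= eta ->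
  (forall t i, 0 <= t -> t <= T -> `|z t i 0| <= B) ->
  (forall i j, `|M' i j| <= K) ->
  (forall i j, `|M i j - M' i j| <= eta) ->
  forall t, 0 <= t -> t <= T ->
  norm2 (z t - z' t) ^+ 2 <=
    N%:R ^+ 2 * (eta * B) ^+ 2 * T * expR (N%:R * (2 * K + 1) * T).
Proof.
move=> sz sz' T0 K0 eta0 zB MK Meta t t0 tT.
have zc := solves_linear_ode_coord sz; have zc' := solves_linear_ode_coord sz'.
pose e i s := z s i 0 - z' s i 0.
pose de i s := \sum_j M i j * z s j 0 - \sum_j M' i j * z' s j 0.
pose u s := \sum_i e i s ^+ 2.
pose du s := \sum_i (2 * e i s * de i s).
have cu : {within `[0, +oo[, continuous u}.
  have ce i : {within `[0, +oo[, continuous (e i)}.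
    by apply: within_continuousB; [case: (zc i)|case: (zc' i)].
  move=> s; apply: cvg_big => [|i _]; first exact: add_continuous.
  exact: (cvg_comp _ _ (ce i s) (@exprn_continuous _ 2 _)).
have u' (s : R) : 0 < s -> is_derive s 1 u (du s).
  move=> s0.
  have -> : u = \sum_i (e i ^+ 2).
    by apply/funext => r; rewrite /u fct_sumE.
  have de' i : is_derive s 1 (e i ^+ 2) (2 * e i s * de i s).
    have [_ _ /(_ s s0) d1] := zc i; have [_ _ /(_ s s0) d2] := zc' i.
    have d3 : is_derive s 1 (e i) (de i s) by apply: is_deriveB.
    apply: is_derive_eq; rewrite /GRing.scale/= expr1; ring.
  exact: is_derive_sum.
have u0 : u 0 = 0.
  rewrite /u big1// => i _; rewrite /e.
  by have [-> _ _] := zc i; have [-> _ _] := zc' i; rewrite subrr expr0n.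
have -> : norm2 (z t - z' t) ^+ 2 = u t.
  rewrite /norm2 sqr_sqrtr; last by apply: sumr_ge0 => i _; exact: sqr_ge0.
  by apply: eq_bigr => i _; rewrite !mxE.
have c0 : 0 <= N%:R * (2 * K + 1) :> R by rewrite mulr_ge0// addr_ge0// mulr_ge0.
have b0 : 0 <= N%:R ^+ 2 * (eta * B) ^+ 2 :> R by rewrite mulr_ge0// sqr_ge0.
suff dle s : 0 < s -> s <= T ->
    du s <= N%:R * (2 * K + 1) * u s + N%:R ^+ 2 * (eta * B) ^+ 2.
  apply: le_trans (gronwall T0 c0 b0 cu u' u0 dle t0 tT) _.
  apply: ler_pM; [exact: mulr_ge0|exact: expR_ge0|exact: ler_wpM2l|].
  by rewrite ler_expR ler_wpM2l.
move=> s0 sT.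
(* The part M' (z - z') contributes K (e_i^2 + e_j^2), the part (M - M') z contributes e_i^2 + (eta
   B)^2. Summed over i and j this gives N (2K + 1) u + N^2 (eta B)^2. *)
have term i j : 2 * e i s * (M i j * z s j 0 - M' i j * z' s j 0) <=
    (K + 1) * e i s ^+ 2 + K * e j s ^+ 2 + (eta * B) ^+ 2.
  have -> : M i j * z s j 0 - M' i j * z' s j 0 =
    M' i j * e j s + (M i j - M' i j) * z s j 0 by rewrite /e; ring.
  have H1 := ler_bilin (e i s) (e j s) (MK i j).
  have H2 : `|(M i j - M' i j) * z s j 0| <= eta * B.
    by rewrite normrM ler_pM// ?Meta// zB// ltW.
  have /(_ (e i s)) H3 := ler_bilin_sqr _ H2.
  move: H1 H3; move: (e i s) (e j s) (M' i j * e j s) (_ * z s j 0) => x y p q H1 H3.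
  rewrite mulrDr; apply: le_trans (lerD H1 H3) _.
  by rewrite le_eqVlt; apply/orP; left; apply/eqP; ring.
rewrite /du; apply: (@le_trans _ _ (\sum_i \sum_j
    ((K + 1) * e i s ^+ 2 + K * e j s ^+ 2 + (eta * B) ^+ 2))).
  apply: ler_sum => i _; rewrite /de -sumrB mulr_sumr.
  by apply: ler_sum => j _; exact: term.
under eq_bigr do rewrite big_split/= big_split/= -mulr_sumr -/(u s) !sumr_const card_ord.
rewrite big_split/= big_split/= sumrMnl -mulr_sumr -/(u s) !sumr_const card_ord.
rewrite le_eqVlt; apply/orP; left; apply/eqP.
rewrite -!mulr_sumr sumrMnl -/(u s).
set n : R := N%:R; have E r : r *+ N = n * r by rewrite mulr_natl.
rewrite !E; clear E; move: (u s) (eta * B) n => p q n; ring.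
Qed.

(** With S_n the n-th partial sum, z - S_(n+1) vanishes at 0 and has derivative M (z - S_n).
    Induction on n then bounds the error by B (C t)^n / n!, where B bounds z on [0, t] and C = N K
    with K a bound on the entries of M. The partial sums are polynomial in the entries of M, hence
    measurable when M is random. *)
Lemma linear_ode_taylor M (z0 : 'cV[R]_N) z : solves_linear_ode M z0 z ->
  forall t i, 0 <= t ->
  \sum_(0 <= k < n) (t ^+ k / k`!%:R * iter k (mulmx M) z0 i 0) @[n --> \oo] --> z t i 0.
Proof.
move=> sz t i t0.
have zc := solves_linear_ode_coord sz.
have [B B0 zB] : exists2 B : R, 0 <= B & forall s i, 0 <= s -> s <= t -> `|z s i 0| <= B.
  by apply: bounded_coord => // j; have [] := zc j.
have [K K0 MK] : exists2 K : R, 0 <= K & forall i j, `|M i j| <= K.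
  exists (\sum_i \sum_j `|M i j|); first by do 2 apply: sumr_ge0 => ? _.
  move=> k l; rewrite (bigD1 k)//= (bigD1 l)//= -addrA lerDl addr_ge0// sumr_ge0//.
  by move=> ? _; exact: sumr_ge0.
pose S n (s : R) i := \sum_(0 <= k < n) (s ^+ k / k`!%:R * iter k (mulmx M) z0 i 0).
pose C : R := N%:R * K.
have C0 : 0 <= C by rewrite mulr_ge0.
have S0 n j : S n.+1 0 j = z0 j 0.
  rewrite /S big_nat_recl//= expr0 fact0 divr1 mul1r big1 ?addr0// => k _.
  by rewrite expr0n/= mul0r mul0r.
have dS n (s : R) j : is_derive s 1 (fun s => S n.+1 s j) (\sum_l M j l * S n s l).
  rewrite [X in is_derive _ _ X _](_ : _ = (fun s =>
      \sum_(k < n.+1) (s ^+ k / k`!%:R * iter k (mulmx M) z0 j 0))); last first.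
    by apply/funext => r; rewrite /S big_mkord.
  rewrite [X in is_derive _ _ X _](_ : _ =
      \sum_(k < n.+1) (fun s => (s ^+ k / k`!%:R * iter k (mulmx M) z0 j 0))); last first.
    by apply/funext => r; rewrite fct_sumE.
  have d (k : 'I_n.+1) : is_derive s 1 (fun s => s ^+ k / k`!%:R * iter k (mulmx M) z0 j 0)
      (s ^+ k.-1 * k%:R / k`!%:R * iter k (mulmx M) z0 j 0).
    have := is_derive_monomial k (k`!%:R^-1 * iter k (mulmx M) z0 j 0) s.
    rewrite [X in is_derive _ _ X _ -> _](_ : _ =
      (fun s => s ^+ k / k`!%:R * iter k (mulmx M) z0 j 0)); last first.
      by apply/funext => r; ring.
    by move=> h; apply: is_derive_eq; ring.
  suff <- : \sum_(k < n.+1) (s ^+ k.-1 * k%:R / k`!%:R * iter k (mulmx M) z0 j 0) =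
      \sum_l M j l * S n s l by exact: is_derive_sum d.
  (* The constant term has derivative 0; the other terms are reindexed by one, and one factor M is
     split off the iterate. *)
  rewrite big_ord_recl/= mulr0 mul0r mul0r add0r.
  under [RHS]eq_bigr do rewrite /S big_mkord mulr_sumr.
  rewrite exchange_big/=; apply: eq_bigr => k _.
  rewrite /bump/= add1n add0n/= mxE mulr_sumr; apply: eq_bigr => l _.
  have -> : s ^+ k * k.+1%:R / (k.+1)`!%:R = s ^+ k / k`!%:R :> R.
    rewrite factS natrM; field.
    by rewrite nat1r !pnatr_eq0 -lt0n fact_gt0.
  by ring.
have bound n : forall s j, 0 <= s -> s <= t ->
    `|z s j 0 - S n s j| <= B * ((C * s) ^+ n / n`!%:R).
  elim: n => [|n IH] s j s0 st.
    by rewrite /S big_geq// subr0 expr0 fact0 divr1 mulr1 zB.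
  pose g (s : R) := B * ((C * s) ^+ n.+1 / (n.+1)`!%:R).
  have g0 : g 0 = 0 by rewrite /g mulr0 expr0n/= mul0r mulr0.
  pose dg (r : R) := B * C * ((C * r) ^+ n / n`!%:R).
  have g' (r : R) : is_derive r 1 g (dg r).
    have := is_derive_monomial n.+1 (B * C ^+ n.+1 / (n.+1)`!%:R) r.
    rewrite [X in is_derive _ _ X _ -> _](_ : _ = g); last first.
      apply/funext => x; rewrite /g (exprMn_comm _ (mulrC C x)); ring.
    move=> h; apply: is_derive_eq; rewrite /dg (exprMn_comm _ (mulrC C r)).
    rewrite factS natrM exprS/=; field.
    by rewrite nat1r !pnatr_eq0 -lt0n fact_gt0.
  have cg : continuous g.
    by move=> r; apply/differentiable_continuous/derivable1_diffP; have [] := g' r.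
  pose h (r : R) := z r j 0 - S n.+1 r j.
  have cS : continuous (fun s => S n.+1 s j).
    by move=> r; apply/differentiable_continuous/derivable1_diffP; have [] := dS n r j.
  have ch : {within `[0, +oo[, continuous h}.
    by apply: within_continuousB; [case: (zc j)|exact: continuous_subspaceT].
  pose dh (r : R) := \sum_l M j l * (z r l 0 - S n r l).
  have h' (r : R) : 0 < r -> is_derive r 1 h (dh r).
    move=> r0; have [_ _ /(_ r r0) d1] := zc j; have d2 := dS n r j.
    have -> : dh r = \sum_l M j l * z r l 0 - \sum_l M j l * S n r l.
      by rewrite -sumrB; apply: eq_bigr => l _; rewrite mulrBr.
    exact: is_deriveB.
  have h0 : h 0 = 0 by rewrite /h S0; have [-> _ _] := zc j; rewrite subrr.
  have dhg r : 0 < r -> r <= t -> `|dh r| <= dg r.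
    move=> r0 rt; apply: le_trans (ler_norm_sum _ _ _) _.
    apply: (@le_trans _ _ (\sum_(l < N) K * (B * ((C * r) ^+ n / n`!%:R)))).
      by apply: ler_sum => l _; rewrite normrM ler_pM// IH// ltW.
    rewrite sumr_const card_ord /dg; move: ((C * r) ^+ n / n`!%:R) => w.
    by rewrite -mulr_natl le_eqVlt; apply/orP; left; apply/eqP; rewrite /C; ring.
  have cgT : {within `[0, +oo[, continuous g} by exact: continuous_subspaceT.
  (* Since g(0) = h(0) = 0 and |h'| <= g', both h - g and - h - g are nonincreasing from 0; they
     give the two sides of the bound. *)
  rewrite ler_norml; apply/andP; split; last first.
    have := @le_init_derive_le0 (h \- g) (fun r => dh r - dg r) t t0.
    move=> /(_ _ _ _ s s0 st); rewrite /= h0 g0 subr0 subr_le0; apply.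
    - exact: within_continuousB.
    - by move=> r r0; apply: is_deriveB; exact: h'.
    - by move=> r r0 rt; rewrite subr_le0; apply: le_trans (ler_norm _) (dhg _ _ _).
  have := @le_init_derive_le0 (fun r => - h r - g r) (fun r => - dh r - dg r) t t0.
  move=> /(_ _ _ _ s s0 st); rewrite /= h0 g0 !oppr0 addr0 subr_le0 lerNl; apply.
  - apply: within_continuousB => //.
    by move=> r; apply: continuousN; exact: ch.
  - move=> r r0; have := h' r r0 => ?; exact: is_deriveB.
  - move=> r r0 rt; rewrite subr_le0; apply: le_trans (dhg _ r0 rt).
    by rewrite -normrN ler_norm.
apply/cvgrPdist_le => eps eps0.
have : B * exp_coeff (C * t) n @[n --> \oo] --> B * 0.
  by apply: cvgM; [exact: cvg_cst|exact: cvg_exp_coeff].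
rewrite mulr0 => /cvgrPdist_le /(_ _ eps0).
apply: filterS => n; rewrite sub0r normrN => hn.
by apply: le_trans (bound n t i t0 (lexx _)) _; apply: le_trans (ler_norm _) hn.
Qed.

End ode.

(** * Matrices *)

Section matrix_perturbation.
Context {R : realType}.

Lemma ler_mx_entry m n (A : 'M[R]_(m, n)) i j : `|A i j| <= `|A|.
Proof.
rewrite [leRHS]/Num.Def.normr/= mx_normrE.
exact: (le_bigmax _ (fun ij => `|A ij.1 ij.2|) (i, j)).
Qed.

Lemma mx_norm_le m n (A : 'M[R]_(m, n)) b : 0 <= b ->
  (forall i j, `|A i j| <= b) -> `|A| <= b.
Proof.
move=> b0 Ab; rewrite [leLHS]/Num.Def.normr/= mx_normrE.
by apply: bigmax_le => // ij _; exact: Ab.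
Qed.

Lemma ler_norm_mulmx m n p (A : 'M[R]_(m, n)) (B : 'M[R]_(n, p)) :
  `|A *m B| <= n%:R * (`|A| * `|B|).
Proof.
apply: mx_norm_le => [|i j]; first by rewrite !mulr_ge0.
rewrite mxE; apply: le_trans (ler_norm_sum _ _ _) _.
apply: (@le_trans _ _ (\sum_(k < n) `|A| * `|B|)).
  by apply: ler_sum => k _; rewrite normrM ler_pM// ler_mx_entry.
by rewrite sumr_const card_ord mulr_natl.
Qed.

(** If v C' = 0, then v = - v (C' - C) C^-1. The norm being the largest absolute entry, each of the
    two products costs a factor n, and the assumption yields |v| <= |v| / 2. *)
Lemma unitmx_near n (C C' : 'M[R]_n) : C \in unitmx ->
  n%:R ^+ 2 * `|invmx C| * `|C' - C| <= 2^-1 -> C' \in unitmx.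
Proof.
move=> Cu small; rewrite -row_free_unit; apply: inj_row_free => v vC'.
have vE : v = - (v *m (C' - C) *m invmx C).
  by rewrite mulmxBr vC' sub0r mulNmx opprK mulmxK.
apply/eqP; rewrite -normr_le0; apply/negP => /negP; rewrite -ltNge => v0.
have : `|v| <= n%:R * (n%:R * (`|v| * `|C' - C|) * `|invmx C|).
  rewrite {1}vE normrN; apply: le_trans (ler_norm_mulmx _ _) _.
  by rewrite ler_wpM2l// ler_wpM2r// ler_norm_mulmx.
have : n%:R ^+ 2 * `|invmx C| * `|C' - C| * `|v| <= 2^-1 * `|v| by rewrite ler_wpM2r.
move: v0 {small vE}.
move: `|v| `|C' - C| `|invmx C| n%:R => a b c k a0 h1 h2.
suff : a <= 2^-1 * a by lra.
by apply: le_trans h2 _; apply: le_trans h1; rewrite le_eqVlt; apply/orP; left; apply/eqP; ring.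
Qed.

(** With M = C^-1 A, the error X = C'^-1 A' - M solves C X = (A' - A) - (C' - C) M - (C' - C) X.
    Multiplying by C^-1 bounds X without any estimate of C'^-1, since the last term can be absorbed
    on the left. *)
Lemma invmx_mulmx_near n (C A : 'M[R]_n) eta : C \in unitmx -> 0 < eta ->
  exists2 e : R, 0 < e & forall C' A' : 'M[R]_n, `|C' - C| <= e -> `|A' - A| <= e ->
    C' \in unitmx /\ `|invmx C' *m A' - invmx C *m A| <= eta.
Proof.
move=> Cu eta0.
pose M := invmx C *m A; pose D := `|invmx C|; pose k : R := n%:R.
have D0 : 0 <= D by exact: normr_ge0.
have k0 : 0 <= k by exact: ler0n.
(* [Q] dominates both coefficients of the radius in the bound of |X|, so the radius r / Q gives |X|
   <= r + |X| / 2. In r = min(1/2, eta/2), the first entry allows the absorption and the second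
   turns |X| <= 2r into |X| <= eta. *)
pose Q := 1 + k * D * (1 + k * `|M|) + k ^+ 2 * D.
have q1 : 0 <= k * D * (1 + k * `|M|) by rewrite !mulr_ge0// addr_ge0// mulr_ge0.
have q2 : 0 <= k ^+ 2 * D by rewrite mulr_ge0// exprn_ge0.
have Q0 : 0 < Q by rewrite /Q; lra.
pose r := Num.min 2^-1 (eta / 2).
have r0 : 0 < r by rewrite lt_min invr_gt0 ltr0n divr_gt0.
have rQ : r / Q * Q = r by rewrite mulfVK// gt_eqF.
exists (r / Q) => [|C' A' hC hA]; first by rewrite divr_gt0.
have e0 : 0 <= r / Q by rewrite divr_ge0// ltW.
have r2 : r <= 2^-1 by rewrite ge_min lexx.
have r3 : r <= eta / 2 by rewrite ge_min lexx orbT.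
have small : k ^+ 2 * D * (r / Q) <= 2^-1.
  apply: le_trans r2; rewrite -[leRHS]rQ mulrC ler_wpM2l// /Q; lra.
have C'u : C' \in unitmx.
  by apply: (unitmx_near Cu); apply: le_trans small; rewrite ler_wpM2l.
split => //; set X := _ - _.
have XE : X = invmx C *m ((A' - A) - (C' - C) *m M - (C' - C) *m X).
  apply: (can_inj (mulKmx Cu)); rewrite mulKVmx//.
  have h1 : C' *m X = A' - C' *m M by rewrite mulmxBr mulKVmx.
  have h2 : C *m M = A by rewrite mulKVmx.
  rewrite !mulmxBl h1 h2; move: (C' *m M) (C *m X) => P Y.
  by apply/matrixP => i j; rewrite !mxE; ring.
have hX : `|X| <= k * D * (1 + k * `|M|) * (r / Q) + k ^+ 2 * D * (r / Q) * `|X|.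
  rewrite {1}XE; apply: le_trans (ler_norm_mulmx _ _) _.
  rewrite -/D -/k.
  have : `|A' - A - (C' - C) *m M - (C' - C) *m X| <=
      r / Q + k * (r / Q * `|M|) + k * (r / Q * `|X|).
    apply: le_trans (ler_normB _ _) _; apply: lerD.
      apply: le_trans (ler_normB _ _) _; apply: lerD => //.
      by apply: le_trans (ler_norm_mulmx _ _) _; rewrite ler_wpM2l// ler_wpM2r.
    by apply: le_trans (ler_norm_mulmx _ _) _; rewrite ler_wpM2l// ler_wpM2r.
  move=> h; apply: (@le_trans _ _ (k * (D * (r / Q + k * (r / Q * `|M|) + k * (r / Q * `|X|))))).
    by rewrite ler_wpM2l// ler_wpM2l.
  by rewrite le_eqVlt; apply/orP; left; apply/eqP; ring.
have h1 : k * D * (1 + k * `|M|) * (r / Q) <= r.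
  by rewrite -[leRHS]rQ mulrC ler_wpM2l// /Q; lra.
have h2 : k ^+ 2 * D * (r / Q) * `|X| <= 2^-1 * `|X| by rewrite ler_wpM2r.
have : `|X| <= r + 2^-1 * `|X| by apply: le_trans hX _; exact: lerD.
move: `|X| r3; clear => x; lra.
Qed.

End matrix_perturbation.

(** * Measurability of matrix operations *)

Section measurable_matrix.
Context {R : realType} {d : measure_display} {T : measurableType d}.
Variable D : set T.

Definition measurable_mx m n (A : T -> 'M[R]_(m, n)) :=
  forall i j, measurable_fun D (fun w => A w i j).

Lemma measurable_mx_mul m n p (A : T -> 'M[R]_(m, n)) (B : T -> 'M[R]_(n, p)) :
  measurable_mx A -> measurable_mx B -> measurable_mx (fun w => A w *m B w).
Proof.
move=> mA mB i j; under eq_fun do rewrite mxE.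
by apply: measurable_sum => k; exact: measurable_funM.
Qed.

Lemma measurable_det n (A : T -> 'M[R]_n) :
  measurable_mx A -> measurable_fun D (fun w => \det (A w)).
Proof.
move=> mA; apply: measurable_sum => s; apply: measurable_funM => //.
by apply: measurable_prod => i _; exact: mA.
Qed.

Lemma measurable_funV (f : T -> R) :
  measurable_fun D f -> measurable_fun D (fun w => (f w)^-1).
Proof.
move=> mf.
(* Squaring makes the base of the real power nonnegative; at zeros of f both sides are 0, by the
   convention 0^-1 = 0. *)
have -> : (fun w => (f w)^-1) = (fun w => f w * (f w ^+ 2) `^ (-1)).
  apply/funext => w; rewrite powR_inv1 ?sqr_ge0//.
  have [->|fw0] := eqVneq (f w) 0; first by rewrite invr0 mul0r.
  by field.
apply: measurable_funM => //.
apply: (@measurableT_comp _ _ _ _ _ _ (fun x : R => x `^ (-1))) => //.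
exact: measurable_funX.
Qed.

(** On [D] the inverse is given by Cramer's formula: cofactors divided by the determinant. *)
Lemma measurable_invmx n (A : T -> 'M[R]_n) : (forall w, D w -> A w \in unitmx) ->
  measurable_mx A -> measurable_mx (fun w => invmx (A w)).
Proof.
move=> Au mA i j.
apply: (@eq_measurable_fun _ _ _ _ _ (fun w => (\det (A w))^-1 * cofactor (A w) j i)).
  by move=> w; rewrite inE => /Au; rewrite /invmx => ->; rewrite !mxE.
apply: measurable_funM; first exact/measurable_funV/measurable_det.
apply: measurable_funM => //; apply: measurable_det => k l.
by under eq_fun do rewrite !mxE; exact: mA.
Qed.

End measurable_matrix.

Lemma measurable_mx_unit {R : realType} {d : measure_display} {T : measurableType d} n
  (A : T -> 'M[R]_n) : measurable_mx setT A -> measurable [set w | A w \in unitmx].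
Proof.
move=> /measurable_det mA.
have -> : [set w | A w \in unitmx] = (fun w => \det (A w)) @^-1` (~` [set 0]).
  by apply/seteqP; split => w /=; rewrite unitmxE unitfE => /eqP.
by rewrite -[X in measurable X]setTI; apply: mA => //; exact: measurableC.
Qed.

(** * Weak law of large numbers *)

Section ode_event.
Context {R : realType} {d : measure_display} {T : measurableType d} {N : nat}.

(** Where C is singular nothing is known about [z], so measurability is shown on the set [D] of
    invertibility only. There z(t) is the pointwise limit of Taylor polynomials in C^-1 A. *)
Lemma measurable_linear_ode_event (C A : T -> 'M[R]_N) (z0 v : 'cV[R]_N)
    (z : T -> R -> 'cV[R]_N) (t eps : R) :
  measurable_mx setT C -> measurable_mx setT A ->
  (forall w, C w \in unitmx -> solves_linear_ode (invmx (C w) *m A w) z0 (z w)) ->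
  0 <= t -> 0 <= eps ->
  measurable [set w | C w \in unitmx /\ norm2 (v - z w t) <= eps].
Proof.
move=> mC mA hz t0 eps0; set D := [set w | C w \in unitmx].
have mD : measurable D by exact: measurable_mx_unit.
have mz i : measurable_fun D (fun w => z w t i 0).
  apply: (@measurable_fun_cvg _ _ _ D (fun n w => \sum_(0 <= k < n)
      (t ^+ k / k`!%:R * iter k (mulmx (invmx (C w) *m A w)) z0 i 0))).
    move=> n; apply: measurable_sum => k; apply: measurable_funM => //.
    suff : measurable_mx D (fun w => iter k (mulmx (invmx (C w) *m A w)) z0) by exact.
    elim: k => [//|k ih] /=; apply: measurable_mx_mul => //.
    apply: measurable_mx_mul; last by move=> k1 k2; exact: measurable_funTS.
    by apply: measurable_invmx => // k1 k2; exact: measurable_funTS.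
  by move=> w Dw; exact: (linear_ode_taylor (hz w Dw) t0).
have mn : measurable_fun D (fun w => \sum_i (v i 0 - z w t i 0) ^+ 2).
  apply: measurable_sum => i; apply: measurable_funX.
  by apply: measurable_funB.
have vz w : \sum_i (v - z w t) i 0 ^+ 2 = \sum_i (v i 0 - z w t i 0) ^+ 2.
  by apply: eq_bigr => i _; rewrite !mxE.
have -> : [set w | C w \in unitmx /\ norm2 (v - z w t) <= eps] =
    D `&` (fun w => \sum_i (v i 0 - z w t i 0) ^+ 2) @^-1` `]-oo, eps ^+ 2]%classic.
  have nE s : (Num.sqrt s <= eps) = (s <= eps ^+ 2).
    by rewrite -[in LHS](ger0_norm eps0) -sqrtr_sqr ler_sqrt ?sqr_ge0.
  by apply/seteqP; split => w /= [Dw]; rewrite in_itv/= /norm2 vz nE.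
exact: mn.
Qed.

End ode_event.

(** * Law of large numbers in L^1 under geometrically decaying covariances *)

Section weak_lln.
Import HBSimple.
Context {R : realType}.

(** Passing from m to m + 1 adds a row and a column, each at most C r / (1 - r), and a diagonal
    entry at most C. The increment is therefore at most 2 C r / (1 - r) + 2 C = 2 C / (1 - r). *)
Lemma sum_geometric_cov (c : nat -> nat -> R) (C r : R) :
  0 <= C -> 0 <= r -> r < 1 -> (forall k l, c k l = c l k) ->
  (forall k l, (k <= l)%N -> c k l <= C * r ^+ (l - k)) ->
  forall m, \sum_(k < m) \sum_(l < m) c k l <= m%:R * (2 * C / (1 - r)).
Proof.
move=> C0 r0 r1 cC cr; have r1' : 0 < 1 - r by rewrite subr_gt0.
have tail m : \sum_(k < m) r ^+ (m - k) <= r / (1 - r).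
  elim: m => [|m ih]; first by rewrite big_ord0 divr_ge0// ltW.
  rewrite big_ord_recr/= subSnn expr1.
  under eq_bigr => i _ do rewrite subSn ?exprS 1?ltnW//.
  rewrite -mulr_sumr.
  apply: (@le_trans _ _ (r * (r / (1 - r)) + r)); first by rewrite lerD2r ler_wpM2l.
  rewrite le_eqVlt; apply/orP; left; apply/eqP; field; by rewrite gt_eqF.
elim=> [|m ih]; first by rewrite big_ord0 mul0r.
rewrite big_ord_recr/=.
under eq_bigr do rewrite big_ord_recr/=.
rewrite big_split/= big_ord_recr/=.
have -> : \sum_(l < m) c m l = \sum_(l < m) c l m by apply: eq_bigr => l _.
have h1 : \sum_(l < m) c l m <= C * (r / (1 - r)).
  apply: (@le_trans _ _ (C * \sum_(k < m) r ^+ (m - k))); last by rewrite ler_wpM2l.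
  by rewrite mulr_sumr; apply: ler_sum => k _; apply: cr; exact: ltnW.
have h2 : c m m <= C by have := cr m m (leqnn _); rewrite subnn expr0 mulr1.
apply: (@le_trans _ _ (m%:R * (2 * C / (1 - r)) + C * (r / (1 - r)) + (C * (r / (1 - r)) + C * 2))).
  by rewrite -!addrA lerD// lerD// lerD//; lra.
rewrite -addn1 natrD le_eqVlt; apply/orP; left; apply/eqP; field; by rewrite gt_eqF.
Qed.

Context {dS : measure_display} {S : measurableType dS} (mu : probability S R).
Context {dO : measure_display} {Omega : measurableType dO} (P : probability Omega R).
Variable x : nat -> Omega -> S.
Hypothesis mx : forall k, measurable_fun [set: Omega] (x k).
Hypothesis xlaw : forall k (B : set S), measurable B -> P (x k @^-1` B) = mu B.

Definition empirical_mean (f : S -> R) m w := m%:R^-1 * \sum_(k < m) f (x k w).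

Definition empirical_mean_err (f : S -> R) m : \bar R :=
  (\int[P]_w `|empirical_mean f m w - \int[mu]_y f y|%R%:E)%E.

(** Measurability and integrability are bundled with the convergence, so that the closure lemmas
    below transport them along. *)
Definition lln (f : S -> R) := [/\ measurable_fun setT f, mu.-integrable setT (EFin \o f) &
  forall e : R, 0 < e -> exists m0, forall m, (m0 <= m)%N -> (empirical_mean_err f m <= e%:E)%E].

Lemma integral_cst_prob (c : R) : (\int[P]_w c%:E = c%:E)%E.
Proof. by rewrite (integral_cst P measurableT c%:E) [X in (_ * X)%E]probability_setT mule1. Qed.

Lemma measurable_empirical_mean f m : measurable_fun setT f ->
  measurable_fun setT (empirical_mean f m).
Proof.
move=> mf; apply: measurable_funM => //; apply: measurable_sum => k.
exact: measurableT_comp.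
Qed.

Lemma measurable_empirical_mean_err f m (c : R) : measurable_fun setT f ->
  measurable_fun setT (fun w => (`|empirical_mean f m w - c|%R%:E)).
Proof.
move=> mf; apply/measurable_EFinP; apply: measurableT_comp => //.
by apply: measurable_funB => //; exact: measurable_empirical_mean.
Qed.

Lemma llnD f g : lln f -> lln g -> lln (f \+ g).
Proof.
move=> [mf intf hf] [mg intg hg]; split.
- exact: measurable_funD.
- exact: (integrableD _ intf intg).
move=> e e0; have e20 : 0 < e / 2 by rewrite divr_gt0.
have [m1 h1] := hf _ e20; have [m2 h2] := hg _ e20.
exists (maxn m1 m2) => m; rewrite geq_max => /andP[/h1 b1 /h2 b2].
rewrite [e]splitr EFinD; apply: le_trans (leeD b1 b2).
rewrite -ge0_integralD//; try exact: measurable_empirical_mean_err.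
apply: ge0_le_integral => //.
- by apply: measurable_empirical_mean_err; exact: measurable_funD.
- by apply: emeasurable_funD; exact: measurable_empirical_mean_err.
move=> w _; rewrite -EFinD lee_fin RintegralD//.
have -> : empirical_mean (f \+ g) m w = empirical_mean f m w + empirical_mean g m w.
  by rewrite /empirical_mean big_split/= mulrDr.
by rewrite opprD addrACA; exact: ler_normD.
Qed.

Lemma llnZ c f : lln f -> lln (fun y => c * f y).
Proof.
move=> [mf intf hf]; split.
- exact: measurable_funM.
- exact: (integrableZl measurableT c intf).
(* Adding 1 to |c| keeps the denominator positive when c = 0. *)
move=> e e0; have [m1 h1] := hf (e / (`|c| + 1)) (divr_gt0 e0 (ltr_wpDl (normr_ge0 _) ltr01)).
exists m1 => m /h1 b1.
have -> : empirical_mean_err (fun y => c * f y) m = (`|c|%:E * empirical_mean_err f m)%E.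
  rewrite /empirical_mean_err -ge0_integralZl//; last exact: measurable_empirical_mean_err.
  apply: eq_integral => w _; rewrite -EFinM -normrM RintegralZl// mulrBr.
  by rewrite /empirical_mean -mulr_sumr mulrCA.
apply: (@le_trans _ _ (`|c|%:E * (e / (`|c| + 1))%:E)%E).
  by apply: lee_pmul => //; apply: integral_ge0.
rewrite -EFinM lee_fin mulrCA ler_piMr ?(ltW e0)//.
by rewrite ler_pdivrMr ?mul1r ?lerDl// ltr_wpDl.
Qed.

Lemma lln_cst0 : lln (fun=> 0).
Proof.
split => //; first exact: integrable0.
move=> e e0; exists 0%N => m _; rewrite /empirical_mean_err.
under eq_integral => w _ do rewrite /empirical_mean big1// mulr0 Rintegral_cst// mul0r subrr normr0.
by rewrite integral0 lee_fin ltW.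
Qed.

Lemma lln_sum (I : Type) (s : seq I) (F : I -> S -> R) :
  (forall i, lln (F i)) -> lln (fun y => \sum_(i <- s) F i y).
Proof.
move=> hF; elim: s => [|i s ih].
  by rewrite (_ : (fun _ => _) = fun=> 0); [exact: lln_cst0|apply/funext => y; rewrite big_nil].
rewrite (_ : (fun _ => _) = F i \+ (fun y => \sum_(i <- s) F i y)); first exact: llnD.
by apply/funext => y; rewrite big_cons.
Qed.

Lemma integral_norm_sample (f : S -> R) k : measurable_fun setT f ->
  (\int[P]_w `|f (x k w)|%R%:E = \int[mu]_y `|f y|%R%:E)%E.
Proof.
move=> mf.
have := @ge0_integral_pushforward _ _ _ _ R (x k) (mx k) P setT (fun y => `|f y|%R%:E) measurableT.
rewrite preimage_setT /comp => <- //.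
- by apply: eq_measure_integral => B mB _; exact: xlaw.
- by apply/measurable_EFinP; exact: measurableT_comp.
Qed.

(** The triangle inequality and the common law of the samples suffice, whatever their dependence.
    The bound is uniform in m, which is what the approximation argument requires. *)
Lemma integral_norm_empirical_mean f m : measurable_fun setT f -> (0 < m)%N ->
  (\int[P]_w `|empirical_mean f m w|%R%:E <= \int[mu]_y `|f y|%R%:E)%E.
Proof.
move=> mf m0.
have mfk k : measurable_fun setT (fun w => `|f (x k w)|%:E).
  apply/measurable_EFinP; apply: measurableT_comp => //; exact: measurableT_comp.
apply: (@le_trans _ _ (\int[P]_w ((m%:R^-1)%:E * \sum_(k < m) `|f (x k w)|%R%:E))%E).
  apply: ge0_le_integral => //.
  - by apply/measurable_EFinP; apply: measurableT_comp => //; exact: measurable_empirical_mean.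
  - by apply: emeasurable_funM => //; apply: emeasurable_sum.
  - move=> w _; rewrite sumEFin -EFinM lee_fin /empirical_mean normrM ger0_norm// ler_wpM2l//.
    exact: ler_norm_sum.
rewrite ge0_integralZl//; last 2 first.
- exact: emeasurable_sum.
- by move=> w _; apply: sume_ge0.
rewrite ge0_integral_sum//.
under eq_bigr do rewrite integral_norm_sample//.
have sumc n (c : \bar R) : (0 <= c)%E -> (\sum_(k < n) c = n%:R%:E * c)%E.
  move=> c0; elim: n => [|n ih]; first by rewrite big_ord0 mul0e.
  by rewrite big_ord_recr/= ih -{2}[c]mul1e -ge0_muleDl// -EFinD natr1.
rewrite sumc; last exact: integral_ge0.
by rewrite muleA -EFinM mulVf ?mul1e// pnatr_eq0 -lt0n.
Qed.

(** The error for f is at most the sum of three terms, each at most e/3: the error for g, the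
    empirical mean of f - g, and the difference of the integrals. The last two are bounded by the
    L^1(mu) distance of f and g. *)
Lemma lln_approx f : measurable_fun setT f -> mu.-integrable setT (EFin \o f) ->
  (forall e : R, 0 < e -> exists2 g, lln g & (\int[mu]_y `|f y - g y|%R%:E <= e%:E)%E) ->
  lln f.
Proof.
move=> mf intf hf; split => // e e0.
have e30 : 0 < e / 3 by rewrite divr_gt0.
have [g [mg intg hg] fg] := hf _ e30.
have [m0 hm] := hg _ e30.
exists m0.+1 => m m0m; have m_gt0 : (0 < m)%N by apply: leq_trans m0m.
have mfg : measurable_fun setT (f \- g) by exact: measurable_funB.
have intfg : mu.-integrable setT (EFin \o (f \- g)) by exact: (integrableB _ intf intg).
have h1 := hm m (ltnW m0m).
have h2 : (\int[P]_w `|empirical_mean (f \- g) m w|%R%:E <= (e / 3)%:E)%E.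
  exact: le_trans (integral_norm_empirical_mean mfg m_gt0) fg.
have h3 : (`|\int[mu]_y f y - \int[mu]_y g y|%R%:E <= (e / 3)%:E)%E.
  rewrite -RintegralB//; apply: le_trans fg.
  have := le_normr_Rintegral measurableT intfg; rewrite -lee_fin => /le_trans; apply.
  rewrite /Rintegral fineK//=.
  by apply: integrable_fin_num => //; exact: (integrable_abse intfg).
have -> : e%:E = ((e / 3)%:E + ((e / 3)%:E + (e / 3)%:E))%E.
  by rewrite -!EFinD; congr EFin; field.
apply: le_trans (leeD h1 (leeD h2 h3)).
have -> : `|\int[mu]_y f y - \int[mu]_y g y|%R%:E =
  (\int[P]_w `|\int[mu]_y f y - \int[mu]_y g y|%R%:E)%E.
  by rewrite integral_cst_prob.
have mfgE : measurable_fun setT (fun w => `|empirical_mean (f \- g) m w|%:E).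
  by apply/measurable_EFinP; apply: measurableT_comp => //; exact: measurable_empirical_mean.
rewrite -ge0_integralD// -ge0_integralD//; last 3 first.
- exact: measurable_empirical_mean_err.
- by move=> w _; rewrite adde_ge0.
- exact: emeasurable_funD.
apply: ge0_le_integral => //.
- exact: measurable_empirical_mean_err.
- apply: emeasurable_funD; [exact: measurable_empirical_mean_err|exact: emeasurable_funD].
move=> w _; rewrite -!EFinD lee_fin.
have -> : empirical_mean f m w - \int[mu]_y f y = (empirical_mean g m w - \int[mu]_y g y) +
   (empirical_mean (f \- g) m w - (\int[mu]_y f y - \int[mu]_y g y)).
  rewrite /empirical_mean big_split/= sumrN mulrDr mulrN.
  by move: (_ * _) (_ * _) (Rintegral _ _ _) (Rintegral _ _ _) => p q r s; ring.
apply: le_trans (ler_normD _ _) _; rewrite lerD2l.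
exact: ler_normB.
Qed.

(** The left-hand side is the covariance of the indicators of [A] at times k and l. An upper bound
    suffices, because the variance of the mean is only estimated from above. *)
Hypothesis xcov : forall A : set S, measurable A -> exists C r : R,
  [/\ 0 <= C, 0 <= r, r < 1 & forall k l, (k <= l)%N ->
    fine (P (x k @^-1` A `&` x l @^-1` A)) - fine (mu A) ^+ 2 <= C * r ^+ (l - k)].

Lemma integrable_indic_cov (E F : set Omega) (a : R) : measurable E -> measurable F ->
  P.-integrable setT (fun w => ((\1_E w - a) * (\1_F w - a))%:E).
Proof.
move=> mE mF; apply: measurable_bounded_integrable => //.
- by rewrite -ge0_fin_numE// fin_num_measure.
- by apply: measurable_funM; apply: measurable_funB.
exists ((1 + `|a|) ^+ 2); split; first exact: num_real.
move=> y ay w _; apply: le_trans (ltW ay).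
have b G : `|\1_G w - a| <= 1 + `|a|.
  apply: le_trans (ler_normB _ _) _; rewrite lerD2r indicE.
  by case: (_ \in _); rewrite ?normr1 ?normr0.
by rewrite normrM expr2 ler_pM.
Qed.

Lemma integral_indic_cov (E F : set Omega) (a : R) : measurable E -> measurable F ->
  fine (P E) = a -> fine (P F) = a ->
  (\int[P]_w ((\1_E w - a) * (\1_F w - a))%:E = (fine (P (E `&` F)) - a ^+ 2)%:E)%E.
Proof.
move=> mE mF PE PF.
have mEF : measurable (E `&` F) by exact: measurableI.
have iI G : measurable G -> P.-integrable setT (EFin \o (\1_G : Omega -> R)).
  by move=> mG; apply: integrable_indic.
transitivity (\int[P]_w ((\1_(E `&` F) w)%:E
  - (a%:E * (\1_E w)%:E + a%:E * (\1_F w)%:E) + cst (a ^+ 2)%:E w))%E.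
  apply: eq_integral => w _; rewrite indicI /=; congr EFin; ring.
rewrite integralD//; last 2 first.
- apply: integrableB => //; first exact: iI.
  by apply: integrableD => //; apply: integrableZl => //; exact: iI.
- exact: finite_measure_integrable_cst.
rewrite integralB//; last 2 first.
- exact: iI.
- by apply: integrableD => //; apply: integrableZl => //; exact: iI.
rewrite integralD//; try by apply: integrableZl => //; exact: iI.
rewrite !integralZl//; try exact: iI.
rewrite !integral_indic// !setIT integral_cst_prob.
have fk G : measurable G ->
    (P : {measure set Omega -> \bar R}) G = (fine (P G))%:E.
  by move=> mG; rewrite fineK// fin_num_measure.
rewrite (fk E)// (fk F)// (fk (E `&` F))// PE PF /=; congr EFin; ring.
Qed.

(** The squared deviation expands into a double sum of covariances, so its expectation is at most V
    / m. The L^1 error is then controlled by the second moment. *)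
Lemma lln_indic A : measurable A -> lln (\1_A : S -> R).
Proof.
move=> mA; split => //; first by apply: integrable_indic.
have [C [r [C0 r0 r1 cov]]] := xcov mA.
set a := fine (mu A).
have aE : \int[mu]_y (\1_A y) = a by rewrite /Rintegral integral_indic// setIT.
have mAk k : measurable (x k @^-1` A) by rewrite -[X in measurable X]setTI; exact: mx.
move=> e e0.
pose V := 2 * C / (1 - r).
have V0 : 0 <= V by rewrite divr_ge0 ?mulr_ge0// subr_ge0 ltW.
(* This choice makes V / m <= e^2 for m beyond [m0]; the successor taken below ensures m > 0. *)
have [m0 hm0] : exists m0 : nat, V / e ^+ 2 <= m0%:R.
  by exists (Num.bound (V / e ^+ 2)); apply/ltW/archi_boundP; rewrite divr_ge0// sqr_ge0.
exists m0.+1 => m m0m; have m_gt0 : (0 < m)%N by apply: leq_trans m0m.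
rewrite /empirical_mean_err aE.
pose h w := empirical_mean \1_A m w - a.
have mh : measurable_fun setT h by apply: measurable_funB => //; exact: measurable_empirical_mean.
have hE w : h w ^+ 2 = m%:R ^- 2 * \sum_(k < m) \sum_(l < m)
    ((\1_(x k @^-1` A) w - a) * (\1_(x l @^-1` A) w - a)).
  have -> : h w = m%:R^-1 * \sum_(k < m) (\1_(x k @^-1` A) w - a).
    rewrite sumrB sumr_const card_ord mulrBr -[a *+ m]mulr_natl mulKf ?pnatr_eq0 -?lt0n//.
  rewrite exprMn exprVn; congr (_ * _); rewrite expr2 mulr_suml.
  by apply: eq_bigr => k _; rewrite mulr_sumr.
have int2 : (\int[P]_w (h w ^+ 2)%:E <= (e ^+ 2)%:E)%E.
  under eq_integral do rewrite hE EFinM.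
  have ibd (k l : 'I_m) : P.-integrable setT
     (fun w => ((\1_(x k @^-1` A) w - a) * (\1_(x l @^-1` A) w - a))%:E).
    exact: integrable_indic_cov.
  rewrite integralZl//; last first.
    under eq_fun do rewrite -sumEFin; apply: (integrable_sum measurableT) => k _.
    under eq_fun do rewrite -sumEFin; apply: (integrable_sum measurableT) => l _.
    exact: ibd.
  under eq_integral do rewrite -sumEFin.
  rewrite integral_sum//; last first.
    move=> k; under eq_fun do rewrite -sumEFin; exact: (integrable_sum measurableT).
  under eq_bigr => k _.
    under eq_integral do rewrite -sumEFin.
    rewrite integral_sum//.
    under eq_bigr => l _ do rewrite (integral_indic_cov (mAk k) (mAk l))// ?xlaw//.
    rewrite sumEFin.
    over.
  rewrite sumEFin -EFinM lee_fin.
  have /= := @sum_geometric_cov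
    (fun k l => fine (P (x k @^-1` A `&` x l @^-1` A)) - a ^+ 2) C r C0 r0 r1.
  move=> /(_ _ cov m) H.
  apply: (@le_trans _ _ (m%:R ^- 2 * (m%:R * V))).
    by rewrite ler_wpM2l ?invr_ge0 ?exprn_ge0// H// => k l; rewrite setIC.
  have mR0 : 0 < m%:R :> R by rewrite ltr0n.
  have -> : m%:R ^- 2 * (m%:R * V) = V / m%:R by field; rewrite gt_eqF.
  rewrite ler_pdivrMr// -ler_pdivrMl ?exprn_gt0// mulrC.
  by apply: le_trans hm0 _; rewrite ler_nat ltnW.
(* Young's inequality |h| <= e/2 + h^2 / (2e) takes the place of Cauchy-Schwarz; with E h^2 <= e^2
   the right-hand side integrates to at most e. *)
apply: (@le_trans _ _ (\int[P]_w ((e / 2)%:E + ((2 * e)^-1)%:E * (h w ^+ 2)%:E))%E).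
  apply: ge0_le_integral => //.
  - exact: measurable_empirical_mean_err.
  - apply: emeasurable_funD => //; apply: emeasurable_funM => //.
    by apply/measurable_EFinP; exact: measurable_funX.
  move=> w _; rewrite -EFinM -EFinD lee_fin -/(h w).
  rewrite -(real_normK (num_real (h w))).
  move: `|h w| => y.
  have -> : e / 2 + (2 * e)^-1 * y ^+ 2 = y + (2 * e)^-1 * (y - e) ^+ 2.
    by field; rewrite gt_eqF.
  by rewrite lerDl mulr_ge0 ?sqr_ge0// invr_ge0 mulr_ge0// ltW.
rewrite ge0_integralD//; last 3 first.
- by move=> w _; rewrite lee_fin ltW// divr_gt0.
- by move=> w _; rewrite -EFinM lee_fin mulr_ge0 ?invr_ge0 ?sqr_ge0 ?mulr_ge0// ltW.
- by apply: emeasurable_funM => //; apply/measurable_EFinP; exact: measurable_funX.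
rewrite integral_cst_prob ge0_integralZl//; last 3 first.
- by apply/measurable_EFinP; exact: measurable_funX.
- by move=> w _; rewrite lee_fin sqr_ge0.
- by rewrite lee_fin invr_ge0 mulr_ge0// ltW.
apply: (@le_trans _ _ ((e / 2)%:E + ((2 * e)^-1)%:E * (e ^+ 2)%:E)%E).
  by rewrite leeD2l// lee_pmul2l// lte_fin invr_gt0 mulr_gt0.
rewrite -EFinM -EFinD lee_fin le_eqVlt; apply/orP; left; apply/eqP; field.
by rewrite gt_eqF.
Qed.

(** Simple functions are dense in L^1(mu) and are finite combinations of indicators. *)
Lemma lln_integrable f : measurable_fun setT f -> mu.-integrable setT (EFin \o f) -> lln f.
Proof.
move=> mf intf; apply: lln_approx => // e e0.
have [g [intg _ gf]] := approximation_sfun_integrable measurableT intf.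
move/fine_cvgP: gf => [gfin /cvgrPdist_lt /(_ _ e0)].
move=> /(filterI gfin) [n _ /(_ n (leqnn _))] [/= fin]; rewrite sub0r normrN => hn.
exists (g n).
  have -> : (g n : S -> R) = (fun y => \sum_(c <- fset_set (range (g n)))
      (c * \1_(g n @^-1` [set c]) y)).
    by apply/funext => y; rewrite {1}fimfunE fsbig_finite.
  apply: lln_sum => c; apply: llnZ; apply: lln_indic.
  by [].
rewrite -[leLHS]fineK// lee_fin; apply: le_trans (ler_norm _) _.
exact: ltW.
Qed.

End weak_lln.

(** * Shifted solutions of the SDE *)

Section shift.
Context {R : realType}.

Lemma within_continuous_shift (V : topologicalType) (f : R -> V) (r : R) : 0 <= r ->
  {within `[0, +oo[, continuous f} ->
  {within `[0, +oo[, continuous (fun t => f (r + t))}.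
Proof.
move=> r0 /subspace_continuousP cf; apply/subspace_continuousP => t.
rewrite /= in_itv/= andbT => t0.
have rt : [set` `[0, +oo[%R] (r + t) by rewrite /= in_itv/= andbT addr_ge0.
move=> B fB.
have nB : nbhs (r + t) (fun u => [set` `[0, +oo[%R] u -> B (f u)) := cf _ rt _ fB.
suff : nbhs t (fun u => [set` `[0, +oo[%R] u -> B (f (r + u))) by [].
have cs : (r + u) @[u --> t] --> r + t by apply: cvgD; [exact: cvg_cst|exact: cvg_id].
have /= cB := cs _ nB.
apply: (@filterS _ _ (nbhs_filter t) _ _ _ cB) => u /=; rewrite !in_itv/= !andbT => h u0.
by apply: h; rewrite addr_ge0.
Qed.

Lemma Rintegral_shift (g : R -> R) (r s t : R) : s <= t ->
  {within `[r + s, r + t], continuous g} ->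
  (\int[lebesgue_measure]_(u in `[s, t]) g (r + u))%R =
  (\int[lebesgue_measure]_(u in `[r + s, r + t]) g u)%R.
Proof.
move=> st cg; rewrite /Rintegral; congr fine.
pose S (u : R) := r + u.
have dS (u : R) : is_derive u 1 S 1.
  have : is_derive u (1 : R) (cst r + id) (0 + 1) by exact: is_deriveD.
  by rewrite add0r.
have S' : derive1 S = cst 1.
  by apply/funext => u; rewrite derive1E; have [_ ->] := dS u.
have cS : continuous S.
  by move=> u; apply: cvgD; [exact: cvg_cst|exact: cvg_id].
rewrite (@integration_by_substitution_increasing R S g s t st) ?S'//.
- by apply: eq_integral => u _; rewrite /= mulr1.
- by move=> x y _ _ xy; rewrite /S ltrD2l.
- by move=> x _; exact: cvg_cst.
- exact: is_cvg_cst.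
- exact: is_cvg_cst.
- split.
  + by move=> x _; have [] := dS x.
  + by apply: cvg_at_right_filter; exact: cS.
  + by apply: cvg_at_left_filter; exact: cS.
Qed.

(** The partition is translated and the subtracted W_r cancels in every increment, so the Riemann
    sums coincide exactly. A shifted solution therefore keeps the same stochastic integral. *)
Lemma ito_sum_shift d (dO : measure_display) (Omega : measurableType dO)
    (W : R -> Omega -> 'cV[R]_d) (H : R -> Omega -> 'M[R]_d) (r s t : R) :
  ito_sum (fun u w => W (r + u) w - W r w) (fun u => H (r + u)) s t =
  ito_sum W H (r + s) (r + t).
Proof.
apply/funext => n; apply/funext => w; rewrite /ito_sum; apply: eq_bigr => k _.
have -> : r + t - (r + s) = t - s by ring.
by rewrite !addrA; congr (_ *m _); rewrite opprB addrA subrK.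
Qed.

Context {d : nat} {X : set 'cV[R]_d} {X0 : X !=set0}.
Context {dO : measure_display} {Omega : measurableType dO} (P : probability Omega R).

Lemma brownian_motion_shift (G : R -> set_system Omega) (W : R -> Omega -> 'cV[R]_d) (r : R) :
  filtration G -> brownian_motion P G W -> 0 <= r ->
  brownian_motion P (fun t => G (r + t)) (fun t w => W (r + t) w - W r w).
Proof.
move=> [sG mG iG] [W0 cW aW iW] r0; split.
- by apply: aeW => w; rewrite addr0 subrr.
- apply: filterS cW => w cw t; apply: cvgB; last exact: cvg_cst.
  exact: (within_continuous_shift r0 cw).
- move=> t t0 i B mB; have rt : 0 <= r + t by rewrite addr_ge0.
  (* Omega is equipped with the sigma-algebra G (r + t), which makes both W_(r+t) and W_r
     measurable, so adaptedness of the difference is ordinary measurability. *)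
  pose T := g_sigma_algebraType (G (r + t)).
  have mT (A : set T) : measurable A <-> G (r + t) A.
    by rewrite /measurable/= sigma_algebra_id//; exact: sG.
  have mW s : 0 <= s -> s <= r + t -> measurable_fun [set: T] (fun w : T => W s w i 0).
    move=> s0 srt _ C mC; rewrite setTI; apply/mT.
    by apply: (iG s) => //; exact: aW.
  have mD : measurable_fun [set: T] (fun w : T => W (r + t) w i 0 - W r w i 0).
    by apply: measurable_funB; apply: mW => //; rewrite lerDl.
  have := mD measurableT B mB; rewrite setTI => /mT.
  by congr (G _ _); apply/funext => w /=; rewrite !mxE.
- move=> s t s0 st A GA B mB.
  rewrite -(_ : r + t - (r + s) = t - s); last by ring.
  rewrite -iW//; [|by rewrite addr_ge0|by rewrite ltrD2l].
  congr (P (A `&` _)); apply/funext => w /=; apply/propext.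
  have E i : (W (r + t) w - W r w) i 0 - (W (r + s) w - W r w) i 0 =
     W (r + t) w i 0 - W (r + s) w i 0 by rewrite !mxE; ring.
  by split => h i; have := h i; rewrite E.
Qed.

Lemma within_continuous_lipschitz (F : state_space X0 -> 'cV[R]_d) (K : R) (A : set R)
    (y : R -> state_space X0) (i : 'I_d) :
  (forall a b, `|F a - F b| <= K * `|ambient a - ambient b|) ->
  {within A, continuous (fun u => ambient (y u))} ->
  {within A, continuous (fun u => F (y u) i 0)}.
Proof.
move=> FK cy t; apply/cvgrPdist_le => e e0.
(* The Lipschitz constant has no prescribed sign; |K| + 1 is a positive substitute to divide by. *)
have K0 : 0 < `|K| + 1 by rewrite ltr_wpDl.
have /cvgrPdist_le /(_ _ (divr_gt0 e0 K0)) := cy t.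
apply: filterS => u h.
apply: (@le_trans _ _ (`|F (y t) - F (y u)|)).
  by have := ler_mx_entry (F (y t) - F (y u)) i 0; rewrite !mxE.
apply: le_trans (FK _ _) _.
apply: (@le_trans _ _ ((`|K| + 1) * `|ambient (y t) - ambient (y u)|)).
  by rewrite ler_wpM2r// (le_trans (ler_norm _))// lerDl.
by rewrite -ler_pdivlMl// mulrC.
Qed.

(** The transition kernel only describes pairs of times 0 and t, but does so for every solution.
    Restarting at time r thus gives access to the joint law at two arbitrary times. The Lipschitz
    bound makes the drift continuous along paths, as the change of variables in its integral
    requires. *)
Lemma sde_solution_shift (F : state_space X0 -> 'cV[R]_d)
    (sigma : state_space X0 -> 'M[R]_d) (G : R -> set_system Omega)
    (W : R -> Omega -> 'cV[R]_d) (Y : R -> Omega -> state_space X0) (r : R) :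
  lipschitz_coefficients F sigma -> 0 <= r ->
  sde_solution P F sigma G W Y ->
  sde_solution P F sigma (fun t => G (r + t)) (fun t w => W (r + t) w - W r w)
    (fun t => Y (r + t)).
Proof.
move=> [K FK] r0 [fG bW cY aY sY]; have [sG mG iG] := fG; split.
- split.
  + by move=> t t0; apply: sG; rewrite addr_ge0.
  + by move=> t t0; apply: mG; rewrite addr_ge0.
  + by move=> s t s0 st; apply: iG; rewrite ?addr_ge0// lerD2l.
- exact: brownian_motion_shift.
- by apply: filterS cY => w cw; exact: (within_continuous_shift r0 cw).
- by move=> t t0 B mB; apply: aY => //; rewrite addr_ge0.
move=> s t s0 st.
have [||I [[mI cI] eI]] := sY (r + s) (r + t); rewrite ?addr_ge0 ?lerD2l//.
exists I; split.
  by split => //; rewrite (ito_sum_shift W (fun u w => sigma (Y u w))).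
move: cY eI; apply: filterS2 => w cw ew i; rewrite ew.
congr (_ + _ + _); rewrite (@Rintegral_shift (fun u => F (Y u w) i 0))//.
have := @within_continuous_lipschitz F K _ _ i (fun a b => (FK a b).1) cw.
apply: continuous_subspaceW => u /=; rewrite !in_itv/= andbT => /andP[+ _].
by apply: le_trans; rewrite addr_ge0.
Qed.

End shift.

(** * Square-integrable functions and the Gram matrix *)

Section L2_facts.
Context {R : realType} {dS : measure_display} {S : measurableType dS}
  (mu : probability S R).

Lemma integrable_mul_L2 (f g : L2 mu) : mu.-integrable setT (EFin \o (fun x => f x * g x)).
Proof.
by apply/Lfun1_integrable; apply: (@Lfun2_mul_Lfun1 _ _ _ mu f g); exact: LfunP.
Qed.

Lemma inner_le_L2norm (f g : L2 mu) : `|inner mu f g| <= L2norm f * L2norm g.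
Proof.
have fin (h : L2 mu) : ('N[mu]_2%:E[EFin \o h])%E \is a fin_num.
  by rewrite ge0_fin_numE ?Lnorm_ge0//; exact: Lfunction_finite.
apply: le_trans (le_normr_Rintegral measurableT (integrable_mul_L2 f g)) _.
rewrite /L2norm -fineM//; apply: fine_le.
- by apply: integrable_fin_num => //; exact: (integrable_abse (integrable_mul_L2 f g)).
- by rewrite fin_numM.
have := @hoelder _ _ _ mu f g 2 2; rewrite Lnorm1; apply => //.
by field.
Qed.

Lemma bounded_Lfun2 (f : S -> R) (M : R) : measurable_fun setT f ->
  (forall x, `|f x| <= M) -> f \in Lfun mu 2%:E.
Proof.
move=> mf fM; rewrite inE/=; apply/andP; split; rewrite inE//=.
rewrite /finite_norm unlock poweR_lty//.
have M0 : 0 <= M by apply: le_trans (fM point).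
apply: (@le_lt_trans _ _ (\int[mu]_x (M `^ 2)%:E)%E).
  rewrite (eq_integral (fun x => (`|f x| `^ 2)%:E))//.
  apply: ge0_le_integral => //.
  - apply/measurable_EFinP; apply: (@measurableT_comp _ _ _ _ _ _ (fun x : R => x `^ 2)) => //.
    exact: measurableT_comp.
  - by move=> x _; rewrite lee_fin ge0_ler_powR// nnegrE.
by rewrite integral_cst_prob ltry.
Qed.

(** If v G = 0, then the integral of (sum_i v_i psi_i)^2 equals v G v^T = 0, so the combination
    vanishes a.e. and v = 0 by independence. *)
Lemma gram_mx_unit (N : nat) (psi : 'I_N -> L2 mu) : lin_indep psi ->
  gram_mx mu (fun i => psi i : S -> R) (fun i => psi i : S -> R) \in unitmx.
Proof.
move=> free; rewrite -row_free_unit; apply: inj_row_free => v vG.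
pose f x := \sum_i v 0 i * psi i x.
have mpsi i : measurable_fun setT (psi i) by [].
have mf : measurable_fun setT f.
  by apply: measurable_sum => i; exact: measurable_funM.
have f2E x : f x ^+ 2 = \sum_i \sum_j (v 0 i * v 0 j) * (psi i x * psi j x).
  rewrite expr2 mulr_suml; apply: eq_bigr => i _; rewrite mulr_sumr.
  by apply: eq_bigr => j _; ring.
have int0 : (\int[mu]_x (f x ^+ 2)%:E = 0)%E.
  under eq_integral do rewrite f2E -sumEFin.
  have ib i j : mu.-integrable setT (fun x => ((v 0 i * v 0 j) * (psi i x * psi j x))%:E).
    exact: (integrableZl measurableT _ (integrable_mul_L2 (psi i) (psi j))).
  rewrite integral_sum//; last first.
    by move=> i; under eq_fun do rewrite -sumEFin; exact: integrable_sum.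
  have E i : (\int[mu]_x (\sum_j (v 0 i * v 0 j) * (psi i x * psi j x))%:E =
      (\sum_j v 0 i * v 0 j * inner mu (psi i) (psi j))%:E)%E.
    under eq_integral do rewrite -sumEFin.
    rewrite integral_sum// -sumEFin; apply: eq_bigr => j _.
    rewrite EFinM /inner /Rintegral fineK; last first.
      exact: (integrable_fin_num measurableT (integrable_mul_L2 (psi i) (psi j))).
    by rewrite -integralZl//; exact: (integrable_mul_L2 (psi i) (psi j)).
  under eq_bigr do rewrite E.
  rewrite sumEFin exchange_big/=; congr EFin; apply: big1 => j _.
  have h : \sum_k v 0 k * inner mu (psi k) (psi j) = 0.
    have /rowP/(_ j) := vG; rewrite !mxE => h; rewrite -[RHS]h.
    by apply: eq_bigr => k _; rewrite mxE.
  under eq_bigr do rewrite mulrAC.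
  by rewrite -mulr_suml h mul0r.
apply/rowP => i; rewrite mxE; apply: (free (v 0)).
have : (\int[mu]_x `|(f x ^+ 2)%:E| = 0)%E.
  by rewrite -int0; apply: eq_integral => x _; rewrite gee0_abs// lee_fin sqr_ge0.
have mf2 : measurable_fun setT (fun x => (f x ^+ 2)%:E).
  by apply/measurable_EFinP; exact: measurable_funX.
move/(ae_eq_integral_abs mu measurableT mf2).
apply: filterS => x /(_ I) /= [] /eqP.
by rewrite sqrf_eq0 => /eqP.
Qed.

End L2_facts.

(** * Covariances of the samples *)

Section sampling.
Context {R : realType}.

Lemma iid_sample_cov {dO dS : measure_display} {Omega : measurableType dO}
    {S : measurableType dS} (P : probability Omega R) (mu : probability S R)
    (x : nat -> Omega -> S) : iid_sample P mu x ->
  forall A, measurable A -> exists C r : R,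
    [/\ 0 <= C, 0 <= r, r < 1 & forall k l, (k <= l)%N ->
    fine (P (x k @^-1` A `&` x l @^-1` A)) - fine (mu A) ^+ 2 <= C * r ^+ (l - k)].
Proof.
(* With r = 0 the bound reads 0 off the diagonal, where independence applies, and 1 on it since 0^0
   = 1. *)
move=> [mx law indep] A mA; exists 1, 0; split => // k l.
rewrite leq_eqVlt => /predU1P[->|kl].
  rewrite subnn expr0 mulr1 setIid lerBlDr.
  apply: (@le_trans _ _ 1); last by rewrite lerDl sqr_ge0.
  have mxA : measurable (x l @^-1` A) by rewrite -[X in measurable X]setTI; apply: mx.
  by rewrite -lee_fin fineK ?fin_num_measure// probability_le1.
(* Independence is stated for initial segments of the samples; whole-space constraints at the other
   indices leave only the factors k and l. *)
pose B (j : nat) : set S := if (j == k) || (j == l) then A else setT.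
have mB j : measurable (B j) by rewrite /B; case: ifP.
have := indep l.+1 B mB.
have -> : [set w | forall j, (j < l.+1)%N -> B j (x j w)] =
    x k @^-1` A `&` x l @^-1` A.
  apply/seteqP; split => w /=.
    move=> h; split.
      by have := h k (ltnW kl : (k < l.+1)%N); rewrite /B eqxx.
    by have := h l (ltnSn l); rewrite /B eqxx orbT.
  by move=> [h1 h2] j _; rewrite /B; case: eqP => [->//|_]; case: eqP => [->//|_].
have PB j : (j != k) && (j != l) -> P (x j @^-1` B j) = 1%E.
  rewrite /B -negb_or => /negbTE ->; rewrite preimage_setT; exact: probability_setT.
rewrite big_ord_recr/= (bigD1 (Ordinal kl))//= big1 ?mule1; last first.
  move=> j jk; apply: PB; rewrite -(inj_eq val_inj) /= in jk; rewrite jk/=.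
  by rewrite ltn_eqF.
rewrite /B !eqxx orbT/= !law// => ->.
rewrite fineM ?fin_num_measure// -expr2 subrr expr0n.
by rewrite subn_eq0 leqNgt kl mulr0.
Qed.

Context {d : nat} {X : set 'cV[R]_d} {X0 : X !=set0}.
Local Notation S := (state_space X0).
Context (p : R -> R.-pker S ~> S) (mu : probability S R).

Lemma koopman_indic t (A : set S) y : measurable A ->
  koopman p t (\1_A) y = fine (p t y A).
Proof. by move=> mA; rewrite /koopman /Rintegral integral_indic// setIT. Qed.

Lemma kernel_fin_num t y (A : set S) : measurable A -> p t y A \is a fin_num.
Proof.
move=> mA; rewrite ge0_fin_numE//; apply: (@le_lt_trans _ _ (p t y setT)).
  by apply: le_measure; rewrite ?inE.
by rewrite prob_kernel ltry.
Qed.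

Lemma kernel_le1 t y (A : set S) : measurable A -> 0 <= fine (p t y A) <= 1.
Proof.
move=> mA; rewrite fine_ge0//= -lee_fin fineK; last exact: kernel_fin_num.
apply: (@le_trans _ _ (p t y setT)); last by rewrite prob_kernel.
by apply: le_measure; rewrite ?inE.
Qed.

Lemma measurable_kernel_fine t (A : set S) : measurable A ->
  measurable_fun setT (fun y => fine (p t y A)).
Proof.
move=> mA; apply: (@measurableT_comp _ _ _ _ _ _ (@fine R)) => //.
exact: measurable_kernel.
Qed.

Lemma integrable_kernel_fine t (A : set S) : measurable A ->
  mu.-integrable setT (EFin \o (fun y => fine (p t y A))).
Proof.
move=> mA; apply: measurable_bounded_integrable => //.
- by rewrite -ge0_fin_numE// fin_num_measure.
- exact: measurable_kernel_fine.
exists 1; split; first exact: num_real.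
move=> M M1 y _; apply: le_trans (ltW M1).
by have /andP[h0 h1] := kernel_le1 t y mA; rewrite ger0_norm.
Qed.

(** The left-hand side is the inner product of 1_A with U_t (1_A - mu A). As 1_A - mu A is
    orthogonal to the constants, Cauchy-Schwarz and exponential stability apply. *)
Lemma koopman_decay (U : R -> L2 mu -> L2 mu) (A : set S) :
  koopman_semigroup p U -> exponentially_stable U -> measurable A ->
  exists C omega : R, [/\ 0 <= C, 0 < omega & forall t, 0 <= t ->
    fine (\int[mu]_(y in A) p t y A)%E - fine (mu A) ^+ 2 <= C * expR (- omega * t)].
Proof.
move=> [_ hU] [M [omega [M1 omega0 hM]]] mA.
set a := fine (mu A).
have m1 : measurable_fun setT (\1_A : S -> R) by [].
have b1 y : `|\1_A y : R| <= 1.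
  by rewrite indicE; case: (_ \in _); rewrite ?normr1 ?normr0.
have mg : measurable_fun setT (fun y => \1_A y - a : R) by exact: measurable_funB.
have bg y : `|\1_A y - a : R| <= 1 + `|a|.
  by apply: le_trans (ler_normB _ _) _; rewrite lerD2r.
pose f : L2 mu := Lfun_Sub (lee1n 2) (bounded_Lfun2 mu m1 b1).
pose g : L2 mu := Lfun_Sub (lee1n 2) (bounded_Lfun2 mu mg bg).
have L2norm_ge0 (h : L2 mu) : 0 <= L2norm h by rewrite fine_ge0// Lnorm_ge0.
exists (L2norm f * (M * L2norm g)), omega; split => //.
  by rewrite !mulr_ge0// (le_trans _ M1).
move=> t t0.
have g0 : inner mu g (cst 1) = 0.
  rewrite /inner; under eq_Rintegral do rewrite mulr1.
  rewrite RintegralB//; last 2 first.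
  - exact: integrable_indic.
  - exact: finite_measure_integrable_cst.
  rewrite /Rintegral integral_indic// setIT integral_cst_prob /= -/a subrr//.
have ht := hM t t0 g g0.
(* The function g is bounded, so [U] acts on it through the kernel, whose total mass 1 preserves the
   constant a. *)
have Ug : {ae mu, forall y, U t g y = fine (p t y A) - a}.
  have bmg : bounded_measurable g by split => //; exists (1 + `|a|).
  apply: filterS (hU t t0 g bmg) => y ->.
  rewrite /koopman/= RintegralB//.
  - by rewrite -koopman_indic// Rintegral_cst// prob_kernel mulr1.
  - by apply: measurable_bounded_integrable => //; rewrite ?prob_kernel ?ltry//; exists 1;
      split; [exact: num_real|move=> B B1 z _; exact: le_trans (b1 z) (ltW B1)].
  - apply: measurable_bounded_integrable => //; rewrite ?prob_kernel ?ltry//.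
    exact: bounded_cst.
have E : inner mu f (U t g) = fine (\int[mu]_(y in A) p t y A)%E - a ^+ 2.
  have ik := integrable_kernel_fine t mA.
  transitivity (\int[mu]_y (\1_A y * fine (p t y A) - a * \1_A y)).
    rewrite /inner /Rintegral; congr fine; apply: ae_eq_integral => //.
    - apply/measurable_EFinP; apply: measurable_funM => //.
    - apply/measurable_EFinP; apply: measurable_funB; apply: measurable_funM => //.
      exact: measurable_kernel_fine.
    by apply: filterS Ug => y + _ => /= ->; congr EFin; ring.
  have i1 : mu.-integrable setT (EFin \o (\1_A : S -> R)) by exact: integrable_indic.
  have i2 : mu.-integrable setT (EFin \o (fun y => \1_A y * fine (p t y A))).
    apply: (le_integrable measurableT _ _ ik).
      by apply/measurable_EFinP; apply: measurable_funM => //; exact: measurable_kernel_fine.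
    by move=> y _; rewrite /= lee_fin normrM ler_piMl.
  rewrite RintegralB//; last exact: (integrableZl measurableT a i1).
  rewrite RintegralZl// expr2; congr (_ - _ * _); last first.
    by rewrite /Rintegral integral_indic// setIT.
  rewrite /Rintegral [in RHS]integral_mkcond; congr fine; apply: eq_integral => y _.
  rewrite patchE indicE; case: ifPn => yA; last by rewrite mul0r.
  by rewrite mul1r fineK//; exact: kernel_fin_num.
rewrite -E; apply: le_trans (ler_norm _) _.
apply: le_trans (inner_le_L2norm f (U t g)) _.
apply: (@le_trans _ _ (L2norm f * (M * expR (- omega * t) * L2norm g))).
  by rewrite ler_wpM2l.
by rewrite le_eqVlt; apply/orP; left; apply/eqP; ring.
Qed.

Context {dO : measure_display} {Omega : measurableType dO} (P : probability Omega R).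
Context (F : S -> 'cV[R]_d) (sigma : S -> 'M[R]_d).
Hypothesis hp : transition_kernel F sigma p.

Lemma sde_solution_measurable G W (Y : R -> Omega -> S) t :
  sde_solution P F sigma G W Y -> 0 <= t -> measurable_fun setT (Y t).
Proof.
move=> [[_ mG _] _ _ aY _] t0 _ B mB; rewrite setTI; apply: (mG t t0).
exact: aY.
Qed.

(** Pushing forward along [Y 0], whose law is [mu], moves the integral of the kernel from Omega to
    the state space. *)
Lemma sde_solution_transition G W (Y : R -> Omega -> S) t A B :
  sde_solution P F sigma G W Y ->
  (forall C, measurable C -> P (Y 0 @^-1` C) = mu C) ->
  0 <= t -> measurable A -> measurable B ->
  P (Y 0 @^-1` A `&` Y t @^-1` B) = (\int[mu]_(y in A) p t y B)%E.
Proof.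
move=> sol law t0 mA mB; rewrite (hp.2 _ _ _ _ _ _ sol)//.
have mY := sde_solution_measurable sol (lexx 0).
have := @ge0_integral_pushforward _ _ _ _ R (Y 0) mY P A (fun y => p t y B) mA.
rewrite /comp => <- //.
- by apply: eq_measure_integral => C mC _; exact: law.
- by apply: measurable_funTS; exact: measurable_kernel.
Qed.

Lemma invariant_kernel t B : invariant_measure p mu -> 0 <= t -> measurable B ->
  (\int[mu]_y p t y B = mu B)%E.
Proof.
move=> inv t0 mB.
have bm : bounded_measurable (\1_B : S -> R).
  split => //; exists 1 => y.
  by rewrite indicE; case: (_ \in _); rewrite ?normr1 ?normr0.
have := inv _ bm t t0.
under eq_Rintegral do rewrite koopman_indic//.
have i1 : mu.-integrable setT (EFin \o (\1_B : S -> R)) by exact: integrable_indic.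
(* Invariance is an identity of real integrals; finiteness of both sides lifts it to extended
   reals. *)
move/(congr1 (@EFin R)); rewrite /Rintegral.
rewrite fineK; last exact: (integrable_fin_num measurableT (integrable_kernel_fine t mB)).
rewrite fineK; last exact: (integrable_fin_num measurableT i1).
rewrite integral_indic// setIT => <-; apply: eq_integral => y _.
by rewrite fineK//; exact: kernel_fin_num.
Qed.

Lemma sde_solution_law G W (Y : R -> Omega -> S) t B :
  sde_solution P F sigma G W Y ->
  (forall C, measurable C -> P (Y 0 @^-1` C) = mu C) ->
  invariant_measure p mu -> 0 <= t -> measurable B ->
  P (Y t @^-1` B) = mu B.
Proof.
move=> sol law inv t0 mB.
rewrite -(invariant_kernel inv t0 mB).
by rewrite -(sde_solution_transition sol law t0 measurableT mB) preimage_setT setTI.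
Qed.

Lemma ergodic_sample_law (U : R -> L2 mu -> L2 mu) x : ergodic_sample P F sigma p U x ->
  (forall k, measurable_fun setT (x k)) /\
  (forall k (B : set S), measurable B -> P (x k @^-1` B) = mu B).
Proof.
move=> [inv _ _ [Dt [G [W [Y [Dt0 sol law xE]]]]]].
have k0 k : 0 <= k%:R * Dt by rewrite mulr_ge0// ltW.
have xE' k : x k = Y (k%:R * Dt) by apply/funext => w; exact: xE.
split => k; first by rewrite xE'; exact: sde_solution_measurable sol _.
by move=> B mB; rewrite xE'; exact: sde_solution_law sol law inv _ mB.
Qed.

Lemma ergodic_sample_cov (hlip : lipschitz_coefficients F sigma) (U : R -> L2 mu -> L2 mu) x :
  koopman_semigroup p U -> ergodic_sample P F sigma p U x ->
  forall A, measurable A -> exists C r : R,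
    [/\ 0 <= C, 0 <= r, r < 1 & forall k l, (k <= l)%N ->
    fine (P (x k @^-1` A `&` x l @^-1` A)) - fine (mu A) ^+ 2 <= C * r ^+ (l - k)].
Proof.
move=> hU [inv _ stable [Dt [G [W [Y [Dt0 sol law xE]]]]]] A mA.
have k0 k : 0 <= k%:R * Dt by rewrite mulr_ge0// ltW.
have xE' k : x k = Y (k%:R * Dt) by apply/funext => w; exact: xE.
have [C [omega [C0 omega0 decay]]] := koopman_decay hU stable mA.
(* The decay over the time (l - k) Dt is the (l - k)-th power of the decay over one step. *)
exists C, (expR (- omega * Dt)); split => //.
  by rewrite expR_lt1 mulNr oppr_lt0 mulr_gt0.
move=> k l kl.
have sol' := sde_solution_shift hlip (k0 k) sol.
have law' B : measurable B -> P (Y (k%:R * Dt + 0) @^-1` B) = mu B.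
  by rewrite addr0; exact: (sde_solution_law sol law inv (k0 k)).
have := decay _ (k0 (l - k)%N).
rewrite -(sde_solution_transition sol' law' (k0 (l - k)%N) mA mA).
rewrite addr0 -mulrDl -natrD subnKC// -!xE'.
by rewrite -expRM_natl mulrCA mulrA.
Qed.

End sampling.

(** * Convergence of the data-driven ODE *)

Section lln_event.
Context {R : realType} {dS : measure_display} {S : measurableType dS} (mu : probability S R).
Context {dO : measure_display} {Omega : measurableType dO} (P : probability Omega R).
Variable x : nat -> Omega -> S.
Hypothesis mx : forall k, measurable_fun [set: Omega] (x k).

(** Markov's inequality for the sum of the errors. The event [E] is quantified after [m0], so a
    single [m0] later serves all times t at once. *)
Lemma lln_event (I : finType) (f : I -> S -> R) (eta delta : R) :
  (forall i, lln mu P x (f i)) -> 0 < eta -> 0 < delta ->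
  exists m0, forall m, (m0 <= m)%N -> forall E, measurable E ->
    (forall w, (forall i, `|empirical_mean x (f i) m w - \int[mu]_y f i y| <= eta) -> E w) ->
    ((1 - delta)%:E <= P E)%E.
Proof.
move=> hf eta0 delta0.
(* The |I| errors then sum to at most eta delta; the 1 keeps the denominator positive when [I] is
   empty. *)
pose c := eta * delta / (#|I|%:R + 1).
have I1 : 0 < #|I|%:R + 1 :> R by rewrite ltr_wpDl.
have c0 : 0 < c by rewrite divr_gt0// mulr_gt0.
have h i : exists m0, forall m, (m0 <= m)%N -> (empirical_mean_err mu P x (f i) m <= c%:E)%E.
  by have [_ _] := hf i; apply.
pose b i := sval (cid (h i)).
exists (\max_i b i) => m m0m E mE sub.
have ferr i : (empirical_mean_err mu P x (f i) m <= c%:E)%E.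
  by apply: (svalP (cid (h i))); apply: leq_trans m0m; exact: (leq_bigmax i).
have me i : measurable_fun setT (fun w => `|empirical_mean x (f i) m w - \int[mu]_y f i y|%:E).
  by have [mf _ _] := hf i; exact: measurable_empirical_mean_err.
have mEC : measurable (~` E) by exact: measurableC.
have : (eta%:E * P (~` E) <= (eta * delta)%:E)%E.
  have -> : (eta%:E * P (~` E) = \int[P]_w (eta%:E * (\1_(~` E) w)%:E))%E.
    rewrite ge0_integralZl//; last by rewrite lee_fin ltW.
      by rewrite integral_indic// setIT.
    by apply/measurable_EFinP.
  (* Outside [E] at least one error exceeds eta, hence so does their sum. *)
  apply: (@le_trans _ _ (\int[P]_w \sum_i (`|empirical_mean x (f i) m w - \int[mu]_y f i y|%:E))%E).
    apply: ge0_le_integral => //.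
    - by move=> w _; rewrite lee_fin mulr_ge0// ltW.
    - by apply: emeasurable_funM => //; apply/measurable_EFinP.
    - by apply: emeasurable_sum.
    move=> w _; rewrite sumEFin lee_fin indicE.
    case: (boolP (w \in ~` E)) => [|_]; last by rewrite mulr0 sumr_ge0.
    rewrite inE => nE; rewrite mulr1.
    have [i hi] : exists i, eta < `|empirical_mean x (f i) m w - \int[mu]_y f i y|.
      apply: contrapT => /forallNP H; apply: nE; apply: sub => i.
      by rewrite leNgt; apply/negP; exact: H.
    by apply: (le_trans (ltW hi)); rewrite (bigD1 i)//= lerDl sumr_ge0.
  rewrite ge0_integral_sum//.
  apply: (@le_trans _ _ (\sum_(i : I) c%:E)%E); first by apply: lee_sum => i _; exact: ferr.
  rewrite sumEFin lee_fin sumr_const -mulr_natl /c mulrA ler_pdivrMr// mulrC.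
  by rewrite ler_wpM2l ?mulr_ge0 ?ltW// ltrDl.
have fin A : measurable A -> P A = (fine (P A))%:E.
  by move=> mA; rewrite fineK// fin_num_measure.
rewrite fin// -EFinM lee_fin ler_pM2l// => hC.
rewrite -(setCK E) probability_setC//; rewrite fin// -EFinB lee_fin.
by rewrite lerD2l lerN2.
Qed.

End lln_event.

Lemma empirical_mxE {R : realType} {dS : measure_display} {S : measurableType dS}
    {dO : measure_display} {Omega : measurableType dO}
    (N : nat) (psi phi : 'I_N -> S -> R) m (x : nat -> Omega -> S) w i j :
  empirical_mx psi phi m (x ^~ w) i j = empirical_mean x (fun y => psi i y * phi j y) m w.
Proof.
rewrite /empirical_mx /empirical_mean !mxE summxE; congr (_ * _); apply: eq_bigr => k _.
by rewrite !mxE big_ord1 !mxE.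
Qed.

(** * Combination of the law of large numbers with the stability estimates *)

Section assembly.
Context {R : realType} {dS : measure_display} {S : measurableType dS} (mu : probability S R).
Context {dO : measure_display} {Omega : measurableType dO} (P : probability Omega R).

Lemma linear_ode_data_driven (x : nat -> Omega -> S) (N : nat) (psi phi : 'I_N -> L2 mu)
  (z0 : 'cV[R]_N) (z : R -> 'cV[R]_N) (zt : nat -> Omega -> R -> 'cV[R]_N)
  (T delta eps : R) :
  (forall k, measurable_fun [set: Omega] (x k)) ->
  (forall f : S -> R, measurable_fun setT f -> mu.-integrable setT (EFin \o f) ->
     lln mu P x f) ->
  lin_indep psi ->
  solves_linear_ode (invmx (gram_mx mu psi psi) *m gram_mx mu psi phi) z0 z ->
  (forall (m : nat) (w : Omega),
     empirical_mx psi psi m (x ^~ w) \in unitmx ->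
     solves_linear_ode
       (invmx (empirical_mx psi psi m (x ^~ w))
          *m empirical_mx psi phi m (x ^~ w)) z0 (zt m w)) ->
  0 < T -> 0 < delta -> 0 < eps ->
  exists m0 : nat, forall m : nat, (m0 <= m)%N ->
    forall t : R, 0 <= t <= T ->
      ((1 - delta)%:E <=
       P [set w | empirical_mx psi psi m (x ^~ w) \in unitmx /\
                  (norm2 (z t - zt m w t) <= eps)%R])%E.
Proof.
move=> mx hlln free hz hzt T0 delta0 eps0.
set C := gram_mx mu psi psi in hz *; set A := gram_mx mu psi phi in hz *.
have Cu : C \in unitmx by exact: gram_mx_unit.
set M := invmx C *m A in hz *.
have [B B0 zB] : exists2 B : R, 0 <= B & forall t i, 0 <= t -> t <= T -> `|z t i 0| <= B.
  by apply: bounded_coord; [exact: ltW|move=> i; have [] := solves_linear_ode_coord hz i].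
pose K := `|M| + 1.
have K0 : 0 <= K by rewrite addr_ge0.
pose Q := N%:R ^+ 2 * B ^+ 2 * T * expR (N%:R * (2 * K + 1) * T).
have Q0 : 0 <= Q by rewrite !mulr_ge0 ?exprn_ge0 ?expR_ge0// ltW.
have Q1 : 0 < 1 + Q by rewrite ltr_pwDl.
(* [Q] is the Gronwall factor without eta^2. The bound eta <= 1 keeps the entries of the empirical
   matrix below K = |M| + 1, and the other one gives eta^2 Q <= eps^2 because Q <= (1 + Q)^2. *)
pose eta := Num.min 1 (eps / (1 + Q)).
have eta0 : 0 < eta by rewrite lt_min ltr01 divr_gt0.
have eta1 : eta <= 1 by rewrite ge_min lexx.
have etaQ : eta ^+ 2 * Q <= eps ^+ 2.
  have h : eta * (1 + Q) <= eps by rewrite -ler_pdivlMr// ge_min lexx orbT.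
  have : (eta * (1 + Q)) ^+ 2 <= eps ^+ 2 by rewrite lerXn2r// nnegrE ?mulr_ge0// ltW.
  apply: le_trans; rewrite exprMn ler_wpM2l ?exprn_ge0 ?(ltW eta0)//.
  rewrite sqrrD expr1n mul1r; have := exprn_ge0 2 Q0; lra.
have [e e0 near] := invmx_mulmx_near A Cu eta0.
pose phis (b : bool) := if b then phi else psi.
(* The boolean selects the entries of C or those of A, so that one finite family controls both
   empirical matrices simultaneously. *)
pose f (ijb : ('I_N * 'I_N) * bool) y := psi ijb.1.1 y * phis ijb.2 ijb.1.2 y.
have hf ijb : lln mu P x (f ijb).
  apply: hlln; last exact: integrable_mul_L2.
  by apply: measurable_funM.
have [m0 hm0] := lln_event mx hf e0 delta0.
exists m0 => m m0m t /andP[t0 tT].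
apply: (hm0 m m0m).
  have memp (g : 'I_N -> L2 mu) : measurable_mx setT (fun w => empirical_mx psi g m (x ^~ w)).
    move=> i j; under eq_fun do rewrite empirical_mxE.
    by apply: measurable_empirical_mean => //; exact: measurable_funM.
  by apply: measurable_linear_ode_event (hzt m) t0 (ltW eps0); exact: memp.
move=> w close /=.
have near1 : `|empirical_mx psi psi m (x ^~ w) - C| <= e.
  apply: mx_norm_le => [|i j]; first exact: ltW.
  rewrite mxE empirical_mxE mxE /C /gram_mx mxE.
  exact: (close ((i, j), false)).
have near2 : `|empirical_mx psi phi m (x ^~ w) - A| <= e.
  apply: mx_norm_le => [|i j]; first exact: ltW.
  rewrite mxE empirical_mxE mxE /A /gram_mx mxE.
  exact: (close ((i, j), true)).
have [Cmu Mm] := near _ _ near1 near2.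
split => //.
have sm := hzt m w Cmu.
set M' := invmx _ *m _ in Mm sm.
have hM' i j : `|M' i j| <= K.
  apply: le_trans (ler_mx_entry _ _ _) _.
  rewrite -(subrK M M') addrC; apply: le_trans (ler_normD _ _) _.
  by rewrite lerD2l (le_trans Mm).
have hMM' i j : `|M i j - M' i j| <= eta.
  by have := ler_mx_entry (M' - M) i j; rewrite !mxE distrC => /le_trans; apply.
have := linear_ode_perturbation hz sm (ltW T0) K0 (ltW eta0) zB hM' hMM' t0 tT.
have -> : N%:R ^+ 2 * (eta * B) ^+ 2 * T * expR (N%:R * (2 * K + 1) * T) = eta ^+ 2 * Q.
  by rewrite /Q; ring.
move=> /le_trans /(_ etaQ).
by rewrite ler_pXn2r// nnegrE ?sqrtr_ge0// ltW.
Qed.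

End assembly.
Theorem corollary13 (R : realType) (d : nat) (X : set 'cV[R]_d)
  (X0 : X !=set0)
  (F : state_space X0 -> 'cV[R]_d) (sigma : state_space X0 -> 'M[R]_d)
  (hlip : lipschitz_coefficients F sigma)
  (p : R -> R.-pker (state_space X0) ~> (state_space X0))
  (hp : transition_kernel F sigma p)
  (mu : probability (state_space X0) R)
  (U : R -> L2 mu -> L2 mu)
  (hU : koopman_semigroup p U)
  (hab : (compact X /\ normalized_lebesgue mu) \/ invariant_measure p mu)
  (dO : measure_display) (Omega : measurableType dO)
  (P : probability Omega R)
  (x : nat -> Omega -> state_space X0)
  (hx : iid_sample P mu x \/ ergodic_sample P F sigma p U x)
  (N : nat) (psi Lpsi : 'I_N -> L2 mu)
  (hpsi : forall i, generates U (psi i) (Lpsi i))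
  (hfree : lin_indep psi)
  (z0 : 'cV[R]_N)
  (z : R -> 'cV[R]_N)
  (hz : solves_linear_ode
          (invmx (gram_mx mu psi psi) *m gram_mx mu psi Lpsi) z0 z)
  (zt : nat -> Omega -> R -> 'cV[R]_N)
  (hzt : forall (m : nat) (w : Omega),
     empirical_mx psi psi m (x ^~ w) \in unitmx ->
     solves_linear_ode
       (invmx (empirical_mx psi psi m (x ^~ w))
          *m empirical_mx psi Lpsi m (x ^~ w)) z0 (zt m w))
  (T delta eps : R) (hT : 0 < T) (hdelta : 0 < delta) (heps : 0 < eps) :
  exists m0 : nat, forall m : nat, (m0 <= m)%N ->
    forall t : R, 0 <= t <= T ->
      ((1 - delta)%:E <=
       P [set w | empirical_mx psi psi m (x ^~ w) \in unitmx /\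
                  (norm2 (z t - zt m w t) <= eps)%R])%E.
Proof.
(* Both sampling schemes are reduced to the same three properties; from here on they are treated
   alike. *)
have [mx law cov] : [/\ forall k, measurable_fun [set: Omega] (x k),
    forall k B, measurable B -> P (x k @^-1` B) = mu B &
    forall A, measurable A -> exists C r : R,
      [/\ 0 <= C, 0 <= r, r < 1 & forall k l, (k <= l)%N ->
      fine (P (x k @^-1` A `&` x l @^-1` A)) - fine (mu A) ^+ 2 <= C * r ^+ (l - k)]].
  case: hx => [iid|erg].
    by split; [case: iid|case: iid|exact: iid_sample_cov].
  have [mx law] := ergodic_sample_law hp erg.
  by split => //; move=> A0 mA0; exact: (ergodic_sample_cov hp hlip hU erg mA0).
apply: (linear_ode_data_driven mx _ hfree hz hzt) => // f mf intf.
exact: (lln_integrable mx law cov mf intf).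
Qed.
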